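(* Let $p$ be a prime and let $D_0$ be the operator on functions on $\mathbb{Z}_p^\times$ defined by $$D_0u(x)=\int_{\mathbb{Z}_p^\times}\frac{u(z)-u(x)}{|z-x|_p^2}\,dz .$$ Then the eigenvalues of $D_0$ are $\lambda_0=0$ and $\lambda_n=-p^{n-1}-p^{n-2}+\frac{2}{p}$ for $n\ge1$. The eigenfunction for $\lambda_0$ is the constant function $1$, and the eigenfunctions for $\lambda_n$ ($n\ge1$) are the characters of $\mathbb{Z}_p^\times$ of conductor $n$. The multiplicities are $m_0=1$, $m_1=p-2$, and $m_n=(p-1)^2p^{n-2}$ for $n\ge2$.
   Context: $|\cdot|_p$ is the $p$-adic absolute value and $dz$ is the additive Haar measure on $\mathbb{Q}_p$ normalized by $\int_{\mathbb{Z}_p}dz=1$. A character of $\mathbb{Z}_p^\times$ is a continuous homomorphism $\chi:\mathbb{Z}_p^\times\to S^1$; the conductor of a nontrivial character $\chi$ is the least integer $n\ge1$ such that $\chi$ is trivial on $1+p^n\mathbb{Z}_p$.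
   Formalization: For p = 2 the value λ_1 has multiplicity m_1 = p−2 = 0 (no character of Z_2^× has conductor 1), so it is not an eigenvalue; the formal theorem lists λ_n as an eigenvalue exactly when m_n > 0. *)

(* Defs.v *)
From HB Require Import structures.
From mathcomp Require Import all_boot all_order all_algebra.
From mathcomp Require Import generic_quotient ring_quotient.
From mathcomp Require Import complex.
From mathcomp Require Import zify ring lra.
From mathcomp Require Import all_classical all_reals all_analysis.

Set Implicit Arguments.
Unset Strict Implicit.
Unset Printing Implicit Defensive.

Import Order.TTheory GRing.Theory Num.Theory.
Import numFieldNormedType.Exports.

Local Open Scope classical_set_scope.
Local Open Scope ring_scope.

Definition padic_abs_rat (p : nat) (q : rat) : rat :=
  if q == 0 then 0
  else p%:R ^ ((logn p `|denq q|%N)%:Z - (logn p `|numq q|%N)%:Z).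

Section PadicAbsRat.
Variables (p : nat) (p_pr : prime p).
Local Notation N := (padic_abs_rat p).

Let p_neq0 : (p%:R : rat) != 0.
Proof. by rewrite pnatr_eq0 -lt0n prime_gt0. Qed.

Let p_gt0 : 0 < (p%:R : rat).
Proof. by rewrite ltr0n prime_gt0. Qed.

Let p_ge1 : 1 <= (p%:R : rat).
Proof. by rewrite ler1n prime_gt0. Qed.

Lemma padic_abs_rat0 : N 0 = 0.
Proof. by rewrite /padic_abs_rat eqxx. Qed.

Lemma padic_abs_rat_gt0 q : q != 0 -> 0 < N q.
Proof. by move=> /negPf q0; rewrite /padic_abs_rat q0 exprz_gt0. Qed.

Lemma padic_abs_rat_ge0 q : 0 <= N q.
Proof.
by have [->|/padic_abs_rat_gt0/ltW//] := eqVneq q 0; rewrite padic_abs_rat0.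
Qed.

Lemma padic_abs_rat_eq0 q : (N q == 0) = (q == 0).
Proof.
have [->|q0] := eqVneq q 0; first by rewrite padic_abs_rat0 eqxx.
exact/negbTE/lt0r_neq0/padic_abs_rat_gt0.
Qed.

Lemma padic_abs_rat_frac (a b : int) : a != 0 -> b != 0 ->
  N (a%:~R / b%:~R) = p%:R ^ ((logn p `|b|%N)%:Z - (logn p `|a|%N)%:Z).
Proof.
move=> a0 b0; set q : rat := _ / _.
have b0' : (b%:~R : rat) != 0 by rewrite intr_eq0.
have q0 : q != 0 by rewrite mulf_neq0 ?invr_eq0 ?intr_eq0.
rewrite /padic_abs_rat (negPf q0); congr (_ ^ _).
have nq0 : numq q != 0 by rewrite numq_eq0.
have dq0 : denq q != 0 by exact: denq_neq0.
have E : numq q * b = a * denq q.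
  apply: (@intr_inj rat); rewrite !rmorphM /=.
  have Eq : (numq q)%:~R / (denq q)%:~R = a%:~R / b%:~R :> rat.
    by rewrite divq_num_den.
  have dq0' : ((denq q)%:~R : rat) != 0 by rewrite intr_eq0.
  by move/eqP: Eq; rewrite eqr_div // => /eqP.
have /(congr1 (logn p)) := congr1 absz E.
rewrite !abszM !lognM ?absz_gt0 // => Ez.
lia.
Qed.

Lemma padic_abs_ratM x y : N (x * y) = N x * N y.
Proof.
have [->|x0] := eqVneq x 0; first by rewrite mul0r padic_abs_rat0 mul0r.
have [->|y0] := eqVneq y 0; first by rewrite mulr0 padic_abs_rat0 mulr0.
rewrite -{1}(divq_num_den x) -{1}(divq_num_den y) mulf_div -!rmorphM /=.
rewrite padic_abs_rat_frac ?mulf_neq0 ?numq_eq0 ?denq_neq0 //.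
rewrite !abszM !lognM ?absz_gt0 ?numq_eq0 ?denq_neq0 //.
rewrite /padic_abs_rat (negPf x0) (negPf y0) -expfzDr //.
by rewrite !PoszD opprD addrACA.
Qed.

Lemma padic_abs_ratN x : N (- x) = N x.
Proof. by rewrite /padic_abs_rat oppr_eq0 numqN denqN abszN. Qed.

Lemma padic_abs_ratB x y : N (x - y) = N (y - x).
Proof. by rewrite -padic_abs_ratN opprB. Qed.

Lemma padic_abs_rat1 : N 1 = 1.
Proof. by rewrite /padic_abs_rat oner_eq0 /= logn1 subrr expr0z. Qed.

Lemma padic_abs_ratV x : N x^-1 = (N x)^-1.
Proof.
have [->|x0] := eqVneq x 0; first by rewrite !(invr0, padic_abs_rat0).
apply: (@mulfI _ (N x)); first by rewrite padic_abs_rat_eq0.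
by rewrite -padic_abs_ratM !mulfV ?padic_abs_rat_eq0 // padic_abs_rat1.
Qed.

Lemma padic_abs_rat_ultra x y : N (x + y) <= Num.max (N x) (N y).
Proof.
have [->|x0] := eqVneq x 0; first by rewrite add0r le_max lexx orbT.
have [->|y0] := eqVneq y 0; first by rewrite addr0 le_max lexx.
have [->|xy0] := eqVneq (x + y) 0.
  by rewrite padic_abs_rat0 le_max padic_abs_rat_ge0.
pose d := denq x * denq y.
pose a := numq x * denq y; pose b := numq y * denq x.
have d0 : d != 0 by rewrite mulf_neq0 ?denq_neq0.
have d0' : (d%:~R : rat) != 0 by rewrite intr_eq0.
have xE : x = a%:~R / d%:~R.
  by rewrite /a /d !rmorphM /= -mulf_div mulfV ?intr_eq0 ?denq_neq0 //
    mulr1 divq_num_den.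
have yE : y = b%:~R / d%:~R.
  by rewrite /b /d !rmorphM /= [X in _ / X]mulrC -mulf_div mulfV
    ?intr_eq0 ?denq_neq0 // mulr1 divq_num_den.
have a0 : a != 0 by rewrite mulf_neq0 ?denq_neq0 ?numq_eq0.
have b0 : b != 0 by rewrite mulf_neq0 ?denq_neq0 ?numq_eq0.
have xyE : x + y = (a + b)%:~R / d%:~R by rewrite xE yE -mulrDl -rmorphD.
have ab0 : a + b != 0.
  by apply: contraNneq xy0 => ab0; rewrite xyE ab0 mul0r.
rewrite xyE xE yE !padic_abs_rat_frac //.
rewrite le_max.
set k := logn p `|a + b|; set ka := logn p `|a|; set kb := logn p `|b|.
have dvdab m : (m <= ka)%N -> (m <= kb)%N -> (m <= k)%N.
  move=> ma mb; rewrite -(pfactor_dvdn _ p_pr) ?absz_gt0 //.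
  have : ((p ^ m)%N%:Z %| a + b)%Z.
    by rewrite rpredD // dvdzE absz_nat pfactor_dvdn ?absz_gt0.
  by rewrite dvdzE.
have : ((ka <= k) || (kb <= k))%N.
  by case/orP: (leq_total ka kb) => h;
    [rewrite (dvdab ka) | rewrite (dvdab kb) ?orbT].
by case/orP => h; apply/orP; [left|right]; apply: ler_weXz2l => //; lia.
Qed.

Lemma padic_abs_ratD x y : N (x + y) <= N x + N y.
Proof.
apply: (le_trans (padic_abs_rat_ultra x y)).
by rewrite ge_max lerDl lerDr !padic_abs_rat_ge0.
Qed.

End PadicAbsRat.

Definition padic_cauchy (p : nat) (p_pr : prime p) : {pred nat -> rat} := fun s =>
  `[< forall e : rat, 0 < e -> exists N : nat, forall m n : nat,
        (N <= m)%N -> (N <= n)%N -> padic_abs_rat p (s m - s n) < e >].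

Record padic_cseq (p : nat) (p_pr : prime p) := PadicCseq {
  padic_cseq_val :> nat -> rat;
  _ : padic_cseq_val \in padic_cauchy p_pr }.

Section PadicCseq.
Variables (p : nat) (p_pr : prime p).
Local Notation N := (padic_abs_rat p).

Let N_ge0 q : 0 <= N q. Proof. exact: padic_abs_rat_ge0. Qed.
Local Hint Resolve N_ge0 : core.

Lemma padic_cauchyP (s : nat -> rat) :
  reflect (forall e : rat, 0 < e -> exists k : nat, forall m n : nat,
             (k <= m)%N -> (k <= n)%N -> N (s m - s n) < e)
          (s \in padic_cauchy p_pr).
Proof. exact: asboolP. Qed.

Lemma padic_cauchy_bounded (s : nat -> rat) : s \in padic_cauchy p_pr ->
  exists2 M : rat, 0 < M & forall n, N (s n) <= M.
Proof.
move=> /padic_cauchyP /(_ 1 ltr01) [k sk].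
exists (1 + N (s k) + \sum_(i < k) N (s i)).
  by rewrite -addrA ltr_pwDl // addr_ge0 // sumr_ge0.
move=> n; case: (leqP k n) => [kn|nk].
  rewrite -[s n](subrK (s k)); apply: (le_trans (padic_abs_ratD p_pr _ _)).
  rewrite -[leLHS]addr0; apply: lerD; first by rewrite lerD2r ltW // sk.
  exact: sumr_ge0.
rewrite (bigD1 (Ordinal nk)) //= addrCA lerDl.
by apply: addr_ge0; [exact: addr_ge0 | exact: sumr_ge0].
Qed.

Lemma padic_cauchy_subring : subring_closed (padic_cauchy p_pr).
Proof.
split=> [|s t /padic_cauchyP Hs /padic_cauchyP Ht|s t Hs Ht].
- apply/padic_cauchyP => e e0; exists 0%N => m n _ _.
  by rewrite subrr padic_abs_rat0.
- apply/padic_cauchyP => e e0.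
  have [k1 H1] := Hs _ e0; have [k2 H2] := Ht _ e0.
  exists (maxn k1 k2) => m n; rewrite !geq_max => /andP[m1 m2] /andP[n1 n2].
  have -> : (s - t) m - (s - t) n = (s m - s n) + (t n - t m).
    change (s m - t m - (s n - t n) = s m - s n + (t n - t m)).
    by ring.
  apply: (le_lt_trans (padic_abs_rat_ultra p_pr _ _)).
  by rewrite gt_max H1 //= H2.
have [A A0 HA] := padic_cauchy_bounded Hs.
have [B B0 HB] := padic_cauchy_bounded Ht.
move: Hs Ht => /padic_cauchyP Hs /padic_cauchyP Ht.
apply/padic_cauchyP => e e0.
have [k1 H1] := Hs _ (divr_gt0 e0 B0); have [k2 H2] := Ht _ (divr_gt0 e0 A0).
exists (maxn k1 k2) => m n; rewrite !geq_max => /andP[m1 m2] /andP[n1 n2].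
have -> : (s * t) m - (s * t) n = s m * (t m - t n) + (s m - s n) * t n.
  change (s m * t m - s n * t n = s m * (t m - t n) + (s m - s n) * t n).
  by ring.
apply: (le_lt_trans (padic_abs_rat_ultra p_pr _ _)).
rewrite gt_max !(padic_abs_ratM p_pr); apply/andP; split.
  apply: (@le_lt_trans _ _ (A * N (t m - t n))).
    by rewrite ler_wpM2r //.
  by rewrite mulrC -ltr_pdivlMr // H2.
apply: (@le_lt_trans _ _ (N (s m - s n) * B)).
  by rewrite ler_wpM2l //.
by rewrite -ltr_pdivlMr // H1.
Qed.

HB.instance Definition _ :=
  GRing.isSubringClosed.Build (nat -> rat) (padic_cauchy p_pr)
    padic_cauchy_subring.

HB.instance Definition _ := [isSub for @padic_cseq_val p p_pr].
HB.instance Definition _ := [Choice of padic_cseq p_pr by <:].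
HB.instance Definition _ :=
  [SubChoice_isSubComNzRing of padic_cseq p_pr by <:].

Definition padic_null : {pred padic_cseq p_pr} := fun s =>
  `[< forall e : rat, 0 < e -> exists k : nat, forall n : nat,
        (k <= n)%N -> N (s n) < e >].

Lemma padic_nullP (s : padic_cseq p_pr) :
  reflect (forall e : rat, 0 < e -> exists k : nat, forall n : nat,
             (k <= n)%N -> N (s n) < e)
          (s \in padic_null).
Proof. exact: asboolP. Qed.

Lemma padic_null_ideal : idealr_closed padic_null.
Proof.
split=> [| |a s t /padic_nullP Hs /padic_nullP Ht].
- by apply/padic_nullP => e e0; exists 0%N => n _; rewrite padic_abs_rat0.
- apply/negP => /padic_nullP /(_ 1 ltr01) [k /(_ k (leqnn k))].
  by rewrite padic_abs_rat1 ltxx.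
have [A A0 HA] := padic_cauchy_bounded (valP a).
apply/padic_nullP => e e0.
have [k1 H1] := Hs _ (divr_gt0 e0 A0); have [k2 H2] := Ht _ e0.
exists (maxn k1 k2) => n; rewrite !geq_max => /andP[n1 n2].
apply: (le_lt_trans (padic_abs_rat_ultra p_pr _ _)).
rewrite gt_max H2 // andbT padic_abs_ratM //.
apply: (@le_lt_trans _ _ (A * N (s n))).
  by rewrite ler_wpM2r // // HA.
by rewrite mulrC -ltr_pdivlMr // H1.
Qed.

HB.instance Definition _ := isIdealr.Build (padic_cseq p_pr) padic_null
  padic_null_ideal.

Lemma padic_cseq_abs_stable (s : padic_cseq p_pr) : s \notin padic_null ->
  exists2 r : rat, 0 < r & exists k : nat, forall n : nat,
    (k <= n)%N -> N (s n) = r.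
Proof.
move=> /padic_nullP /existsNP[e /not_implyP[e0 He]].
have [k sk] := padic_cauchyP _ (valP s) _ e0.
have [n kn eN] : exists2 n, (k <= n)%N & e <= N (s n).
  apply: contrapT => Hn; apply: He; exists k => n kn.
  by rewrite ltNge; apply/negP => en; apply: Hn; exists n.
exists (N (s n)); first exact: lt_le_trans eN.
exists k => m km; apply/eqP; rewrite eq_le; apply/andP; split.
  rewrite -[s m](subrK (s n)); apply: (le_trans (padic_abs_rat_ultra p_pr _ _)).
  by rewrite ge_max lexx andbT ltW // (lt_le_trans (sk _ _ _ _)).
have := padic_abs_rat_ultra p_pr (s n - s m) (s m); rewrite subrK.
rewrite le_max => /orP[] // /le_lt_trans /(_ (sk _ _ kn km)).
by rewrite ltNge eN.
Qed.

Lemma padic_cseq_inv (s : padic_cseq p_pr) : s \notin padic_null ->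
  exists t : padic_cseq p_pr, t * s - 1 \in padic_null.
Proof.
move=> /padic_cseq_abs_stable[r r0 [k sk]].
have tP : (fun n => (s n)^-1) \in padic_cauchy p_pr.
  apply/padic_cauchyP => e e0.
  have er0 : 0 < e * r ^+ 2 by rewrite mulr_gt0 ?exprn_gt0.
  have [k' sk'] := padic_cauchyP _ (valP s) _ er0.
  exists (maxn k k') => m n; rewrite !geq_max => /andP[km k'm] /andP[kn k'n].
  have sm0 : s m != 0 by rewrite -(padic_abs_rat_eq0 p_pr) sk // lt0r_neq0.
  have sn0 : s n != 0 by rewrite -(padic_abs_rat_eq0 p_pr) sk // lt0r_neq0.
  have -> : (s m)^-1 - (s n)^-1 = (s n - s m) / (s m * s n).
    by field; rewrite sn0 sm0.
  rewrite !(padic_abs_ratM p_pr) (padic_abs_ratV p_pr) (padic_abs_ratM p_pr).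
  by rewrite !sk // ltr_pdivrMr ?mulr_gt0 // -expr2 sk'.
exists (PadicCseq tP); apply/padic_nullP => e e0; exists k => n kn.
rewrite [X in N X](_ : _ = (s n)^-1 * s n - 1) //.
have sn0 : s n != 0 by rewrite -(padic_abs_rat_eq0 p_pr) sk // lt0r_neq0.
by rewrite mulVf // subrr padic_abs_rat0.
Qed.

End PadicCseq.

Arguments padic_null {p} p_pr.
Arguments padic_cauchy {p} p_pr.

Definition Qp (p : nat) (p_pr : prime p) : Type :=
  {ideal_quot padic_null p_pr}.

Definition padic_abs (p : nat) (p_pr : prime p) (x : Qp p_pr) : rat :=
  lim ((fun n => padic_abs_rat p (repr x n) : rat^o) @ \oo).

Section QpField.
Variables (p : nat) (p_pr : prime p).
Local Notation N := (padic_abs_rat p).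
Local Notation Qp := (Qp p_pr).
Local Notation abs := (@padic_abs p p_pr).
Local Open Scope quotient_scope.

HB.instance Definition _ := GRing.ComNzRing.on Qp.
HB.instance Definition _ := EqQuotient.on Qp.
HB.instance Definition _ := NzRingQuotient.on Qp.

Definition Qp_of (s : padic_cseq p_pr) : Qp := \pi_Qp s.

Lemma Qp_of_zmod_morphism : zmod_morphism Qp_of.
Proof. by move=> s t; exact: (rmorphB \pi_Qp). Qed.

Lemma Qp_of_monoid_morphism : monoid_morphism Qp_of.
Proof. by split=> [|s t]; [exact: (rmorph1 \pi_Qp)|exact: (rmorphM \pi_Qp)]. Qed.

HB.instance Definition _ := GRing.isZmodMorphism.Build (padic_cseq p_pr) Qp
  Qp_of Qp_of_zmod_morphism.
HB.instance Definition _ := GRing.isMonoidMorphism.Build (padic_cseq p_pr) Qp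
  Qp_of Qp_of_monoid_morphism.

Lemma Qp_reprK (x : Qp) : Qp_of (repr x) = x.
Proof. exact: reprK. Qed.

Lemma Qp_of_eq (s t : padic_cseq p_pr) :
  (Qp_of s == Qp_of t) = (s - t \in padic_null p_pr).
Proof. exact/esym/Quotient.idealrBE. Qed.

Lemma Qp_of_eq0 (s : padic_cseq p_pr) :
  (Qp_of s == 0) = (s \in padic_null p_pr).
Proof. by rewrite -[0](rmorph0 Qp_of) Qp_of_eq subr0. Qed.

Definition Qp_inv (x : Qp) : Qp := if x == 0 then 0 else xget 0 [set y | y * x = 1].

Lemma Qp_mulVf (x : Qp) : x != 0 -> Qp_inv x * x = 1.
Proof.
move=> x0; rewrite /Qp_inv (negPf x0); case: xgetP => // Hx; exfalso.
have [t] : exists t : padic_cseq p_pr, t * repr x - 1 \in padic_null p_pr.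
  by apply: padic_cseq_inv; rewrite -Qp_of_eq0 Qp_reprK.
rewrite -Qp_of_eq => /eqP E; apply: (Hx (Qp_of t)).
rewrite /= -{1}[x]Qp_reprK.
exact: etrans (esym (rmorphM Qp_of _ _)) (etrans E (rmorph1 Qp_of)).
Qed.

Lemma Qp_inv0 : Qp_inv 0 = 0.
Proof. by rewrite /Qp_inv eqxx. Qed.

HB.instance Definition _ := GRing.ComNzRing_isField.Build Qp Qp_mulVf Qp_inv0.

(* The limit defining padic_abs exists and can be computed on any
   representative. *)
Lemma padic_cseq_abs_cvg (s : padic_cseq p_pr) :
  (fun n => N (s n) : rat^o) @ \oo --> (abs (Qp_of s) : rat^o).
Proof.
have cvgs (t : padic_cseq p_pr) : cvg ((fun n => N (t n) : rat^o) @ \oo).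
  have [t0|/padic_cseq_abs_stable[r r0 [k tk]]] :=
    boolP (t \in padic_null p_pr).
    apply/cvg_ex; exists (0 : rat^o); apply/cvgrPdist_lt => e e0.
    have [k tk] := padic_nullP _ t0 _ e0.
    exists k => // n /= kn; rewrite sub0r normrN ger0_norm ?tk //.
    exact: padic_abs_rat_ge0.
  apply/cvg_ex; exists (r : rat^o); apply: cvg_near_cst.
  by exists k => // n /= kn; rewrite tk.
rewrite /padic_abs; set t := repr _.
have /padic_nullP st : s - t \in padic_null p_pr.
  by rewrite -Qp_of_eq Qp_reprK.
apply: (cvg_sub0 _ (cvgs t)); apply/cvgrPdist_lt => e e0.
have [k sk] := st _ e0; exists k => // n /= kn.
rewrite sub0r normrN; apply: le_lt_trans (sk n kn).
have h1 : N (t n) <= N (t n - s n) + N (s n).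
  by rewrite -{1}[t n](subrK (s n)) padic_abs_ratD.
have h2 : N (s n) <= N (s n - t n) + N (t n).
  by rewrite -{1}[s n](subrK (t n)) padic_abs_ratD.
rewrite padic_abs_ratB in h1.
change (`|N (s n) - N (t n)| <= N (s n - t n)).
by rewrite ler_norml; apply/andP; split; lra.
Qed.

Lemma padic_abs_Qp_of_lim (s : padic_cseq p_pr) (l : rat) :
  (fun n => N (s n) : rat^o) @ \oo --> (l : rat^o) -> abs (Qp_of s) = l.
Proof. exact: (cvg_unique _ (@padic_cseq_abs_cvg s)). Qed.

Lemma padic_abs0 : abs 0 = 0.
Proof.
rewrite -[0 in LHS](rmorph0 Qp_of); apply: padic_abs_Qp_of_lim.
by rewrite (_ : (fun _ => _) = cst 0); [exact: cvg_cst|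
  apply/funext => n /=; rewrite padic_abs_rat0].
Qed.

Lemma padic_abs1 : abs 1 = 1.
Proof.
rewrite -[1 in LHS](rmorph1 Qp_of); apply: padic_abs_Qp_of_lim.
by rewrite (_ : (fun _ => _) = cst 1); [exact: cvg_cst|
  apply/funext => n /=; rewrite padic_abs_rat1].
Qed.

Lemma padic_abs_eq0 (x : Qp) : (abs x == 0) = (x == 0).
Proof.
have [->|] := eqVneq x 0; first by rewrite padic_abs0 eqxx.
rewrite -[x]Qp_reprK Qp_of_eq0 => /padic_cseq_abs_stable[r r0 [k sk]].
apply/negbTE; rewrite (_ : abs _ = r) ?lt0r_neq0 //.
apply: padic_abs_Qp_of_lim; apply: cvg_near_cst.
by exists k => // n /= kn; rewrite sk.
Qed.

Lemma padic_absM (x y : Qp) : abs (x * y) = abs x * abs y.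
Proof.
rewrite -[x]Qp_reprK -[y]Qp_reprK -rmorphM /=.
apply: padic_abs_Qp_of_lim.
rewrite (_ : (fun _ => _) =
  (fun n => N (repr x n) : rat^o) \* (fun n => N (repr y n))).
  by apply: cvgM; exact: padic_cseq_abs_cvg.
by apply/funext => n /=; rewrite padic_abs_ratM.
Qed.

Lemma padic_absN (x : Qp) : abs (- x) = abs x.
Proof.
rewrite -[x]Qp_reprK -rmorphN /=; apply: padic_abs_Qp_of_lim.
rewrite (_ : (fun _ => _) = (fun n => N (repr x n) : rat^o)).
  exact: padic_cseq_abs_cvg.
by apply/funext => n /=; rewrite padic_abs_ratN.
Qed.

Lemma padic_abs_ultra (x y : Qp) : abs (x + y) <= Num.max (abs x) (abs y).
Proof.
rewrite -[x]Qp_reprK -[y]Qp_reprK -rmorphD /= maxr_absE.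
pose f (z : Qp) n : rat^o := N (repr z n).
have cf (z : Qp) : f z @ \oo --> (abs (Qp_of (repr z)) : rat^o).
  exact: padic_cseq_abs_cvg.
have cxy := @padic_cseq_abs_cvg (repr x + repr y).
apply: (ler_cvg_to cxy (_ : (fun n => (f x n + f y n + `|f x n - f y n|) / 2%:R)
  @ \oo --> _)).
  apply: cvgM; last exact: cvg_cst.
  by apply: cvgD; [exact: cvgD|apply: cvg_norm; exact: cvgB].
apply: nearW => n; rewrite -maxr_absE; exact: padic_abs_rat_ultra.
Qed.

Lemma padic_abs_ge0 (x : Qp) : 0 <= abs x.
Proof.
have := padic_abs_ultra x (- x).
by rewrite subrr padic_abs0 padic_absN maxxx.
Qed.

Lemma padic_absD (x y : Qp) : abs (x + y) <= abs x + abs y.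
Proof.
apply: (le_trans (padic_abs_ultra x y)).
by rewrite ge_max lerDl lerDr !padic_abs_ge0.
Qed.

Definition Qp_dist (x y : Qp) : rat := abs (x - y).

Lemma Qp_distxx (x : Qp) : Qp_dist x x = 0.
Proof. by rewrite /Qp_dist subrr padic_abs0. Qed.

Lemma Qp_dist_eq0 (x y : Qp) : Qp_dist x y = 0 -> x = y.
Proof. by move=> /eqP; rewrite padic_abs_eq0 subr_eq0 => /eqP. Qed.

Lemma Qp_dist_sym (x y : Qp) : Qp_dist x y = Qp_dist y x.
Proof. by rewrite /Qp_dist -padic_absN opprB. Qed.

Lemma Qp_dist_triangle (y x z : Qp) :
  Qp_dist x z <= Qp_dist x y + Qp_dist y z.
Proof.
by rewrite /Qp_dist (le_trans _ (padic_absD _ _)) // addrA subrK.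
Qed.

HB.instance Definition _ := isPointed.Build Qp 0.
HB.instance Definition _ := @isMetric.Build rat Qp Qp_dist
  Qp_distxx Qp_dist_eq0 Qp_dist_sym Qp_dist_triangle.

End QpField.

Definition Zp (p : nat) (p_pr : prime p) : set (Qp p_pr) :=
  [set x | padic_abs x <= 1].
Arguments Zp {p} p_pr.

Definition Zpx (p : nat) (p_pr : prime p) : set (Qp p_pr) :=
  [set x | Zp p_pr x /\ exists2 y, Zp p_pr y & x * y = 1].
Arguments Zpx {p} p_pr.

Lemma Zp_mul (p : nat) (p_pr : prime p) (x y : Qp p_pr) :
  Zp p_pr x -> Zp p_pr y -> Zp p_pr (x * y).
Proof. by move=> x1 y1; rewrite /Zp /= padic_absM mulr_ile1 ?padic_abs_ge0. Qed.

Lemma Zpx_mul_subproof (p : nat) (p_pr : prime p) (x y : Zpx p_pr) :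
  \val x * \val y \in Zpx p_pr.
Proof.
have [/set_mem[x1 [x' x'1 xx']] /set_mem[y1 [y' y'1 yy']]] := (valP x, valP y).
apply/mem_set; split; first exact: Zp_mul.
by exists (x' * y'); [exact: Zp_mul|rewrite mulrACA xx' yy' mulr1].
Qed.

Definition Zpx_mul (p : nat) (p_pr : prime p) (x y : Zpx p_pr) : Zpx p_pr :=
  exist _ (\val x * \val y) (Zpx_mul_subproof x y).

Definition borelQp (p : nat) (p_pr : prime p) :=
  g_sigma_algebraType (@open (Qp p_pr)).

Definition is_haar (R : realType) (p : nat) (p_pr : prime p)
    (mu : {measure set (borelQp p_pr) -> \bar R}) : Prop :=
  (forall (a : Qp p_pr) (A : set (borelQp p_pr)), measurable A ->
     mu [set a + x | x in A] = mu A)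
  /\ mu (Zp p_pr) = 1%E.

(* The library integrates real-valued functions only: the integral of a
   complex-valued function is taken on real and imaginary parts. *)
Section ComplexIntegral.
Context (d : measure_display) (T : measurableType d) (R : realType).
Variables (mu : {measure set T -> \bar R}) (D : set T) (f : T -> R[i]).

Definition cintegrable : Prop :=
  mu.-integrable D (fun z => (complex.Re (f z))%:E) /\
  mu.-integrable D (fun z => (complex.Im (f z))%:E).

Definition cintegral : R[i] :=
  Complex (\int[mu]_(z in D) complex.Re (f z))
          (\int[mu]_(z in D) complex.Im (f z)).

End ComplexIntegral.

Section Basis.
Variables (K : fieldType) (V : lmodType K).

Definition lin_span (B : set V) : set V :=
  [set v | exists (k : nat) (e : 'I_k -> V) (c : 'I_k -> K),
     (forall i, B (e i)) /\ v = \sum_(i < k) c i *: e i].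

Definition lin_indep (B : set V) : Prop :=
  forall (k : nat) (e : 'I_k -> V) (c : 'I_k -> K),
    injective e -> (forall i, B (e i)) ->
    \sum_(i < k) c i *: e i = 0 -> forall i, c i = 0.

Definition is_basis (B E : set V) : Prop := lin_indep B /\ lin_span B = E.

Definition has_dim (E : set V) (n : nat) : Prop :=
  exists2 B : set V, (B #= `I_n)%card & is_basis B E.

End Basis.

Section Operator.
Variables (R : realType) (p : nat) (p_pr : prime p).
Variable mu : {measure set (borelQp p_pr) -> \bar R}.
Implicit Types (u : Zpx p_pr -> R[i]^o) (x : Zpx p_pr).

(* 'valL_0 u is u extended by 0; it is only integrated over Z_p^*. At z = x
   the quotient is 0 / 0 = 0. *)
Definition D0_integrand u x (z : Qp p_pr) : R[i] :=
  ('valL_0 u z - u x) / ratr (padic_abs (z - \val x) ^+ 2).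

(* The largest domain on which the formula makes sense pointwise: u is Borel and
   the integral converges absolutely at every point x of Z_p^*. *)
Definition D0_domain : set (Zpx p_pr -> R[i]^o) :=
  [set u | forall x, cintegrable mu (Zpx p_pr) (D0_integrand u x)].

Definition D0 u : Zpx p_pr -> R[i]^o :=
  fun x => cintegral mu (Zpx p_pr) (D0_integrand u x).

Definition D0_eigenspace (l : R[i]) : set (Zpx p_pr -> R[i]^o) :=
  [set u | D0_domain u /\ D0 u = l *: u].

Definition D0_eigenvalue (l : R[i]) : Prop :=
  exists2 u, D0_eigenspace l u & u != 0.

End Operator.

Section Characters.
Variables (R : realType) (p : nat) (p_pr : prime p).
Implicit Types chi : Zpx p_pr -> R[i]^o.

Definition is_character chi : Prop :=
  [/\ continuous chi,
      forall x, `|chi x| = 1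
    & forall x y, chi (Zpx_mul x y) = chi x * chi y].

Definition trivial_on chi (A : set (Qp p_pr)) : Prop :=
  forall x, A (\val x) -> chi x = 1.

Definition one_plus_pnZp (n : nat) : set (Qp p_pr) :=
  [set 1 + p%:R ^+ n * z | z in Zp p_pr].

(* The conductor is defined for nontrivial characters only, hence the first
   clause: the constant character 1 would otherwise have conductor 1. *)
Definition has_conductor chi (n : nat) : Prop :=
  [/\ chi != cst 1, (1 <= n)%N, trivial_on chi (one_plus_pnZp n)
    & forall m, (1 <= m)%N -> trivial_on chi (one_plus_pnZp m) -> (n <= m)%N].

End Characters.

(* n = 1 involves p^(-1), hence the integer exponents. *)
Definition lambda (K : fieldType) (p n : nat) : K :=
  if n is 0 then 0
  else - p%:R ^ (n%:Z - 1) - p%:R ^ (n%:Z - 2) + 2 / p%:R.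

Definition mult (p n : nat) : nat :=
  match n with
  | 0 => 1
  | 1 => p - 2
  | n'.+2 => (p - 1) ^ 2 * p ^ n'
  end.

(* Main.v *)
(** The key point is that no regularity of an eigenfunction is assumed.  For
    [x] in [Z_p^*] let [A_k u x] be the average of [u] over the ball
    [x (1 + p^k Z_p)] ([k = 0] giving all of [Z_p^*]) and
    [E_k = A_k - A_(k-1)].  Cutting the integral along the shells
    [|z - x| = p^(-k)] and summing by parts gives, at every point,
    [A_k u x -> u x] and [\sum_(n <= k) lambda_n E_n u x -> D_0 u x].  If
    [D_0 u = l u], the partial sums of [\sum_n (lambda_n - l) E_n u] form a
    martingale for the filtration by balls which tends to 0 everywhere.  Such a
    martingale vanishes: a positive value would persist along a nested sequence
    of balls, hence at their common point.  So [(lambda_n - l) E_n u = 0] for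
    all [n], and the eigenspace of [lambda_n] consists of the functions that
    are invariant under [1 + p^n Z_p] and have average 0 over the cosets of
    [1 + p^(n-1) Z_p].  It remains to do Fourier analysis on the finite group
    [(Z/p^n)^*]. *)

Require Import Defs.
From mathcomp Require Import all_boot all_order all_algebra.
From mathcomp Require Import all_fingroup.
From mathcomp Require Import complex zify ring lra.
From mathcomp Require Import all_classical all_reals all_analysis.
From mathcomp Require Import measurable_realfun separable cyclotomic.

Set Implicit Arguments.
Unset Strict Implicit.
Unset Printing Implicit Defensive.

Import Order.TTheory GRing.Theory Num.Theory.
Import numFieldNormedType.Exports.

Local Open Scope classical_set_scope.
Local Open Scope ring_scope.
Local Notation Zp := Defs.Zp.
Local Arguments lambda : simpl never.

(** * p-adic balls *)

Section PadicBalls.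
Variables (p : nat) (p_pr : prime p).
Local Notation N := (padic_abs_rat p).
Local Notation Qp := (Qp p_pr).
Local Notation abs := (@padic_abs p p_pr).
Local Notation r k := ((p%:R : rat) ^- k).

(** Origin of [lambda]: let [a_k = A_k u x - u x] and let [w_k] be the volume of the ball of level
    [k]. On the shell [|z - x| = p^(-k)] the kernel is [p^(2k) (u z - u x)], so the shell
    contributes [p^(2k) (w_k a_k - w_(k+1) a_(k+1))]. The total coefficient of [a_k] is
    [p^k - p^(k-2)] for [k >= 1] and [w_0 = 1 - 1/p] for [k = 0]. These are the differences
    [lambda_k - lambda_(k+1)], and [lambda_0 = 0] then fixes the constant [2/p]. The summation by
    parts leaves a boundary term of size about [p^k |a_(k+1)|]. The singularity of the kernel
    controls it: the integral of its absolute value over the ball of level [k] bounds [p^k |a_k|],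
    and it tends to 0 because the kernel is integrable. Integrals are taken on real functions while
    [l] is an arbitrary complex number, so the eigenvalue equation is a coupled system for the real
    and imaginary parts of [u]. Both have averages that form martingales, hence so does the
    combination that tends to 0. *)

Lemma invXp_gt0 k : 0 < r k.
Proof. by rewrite invr_gt0 exprn_gt0 // ltr0n prime_gt0. Qed.

Lemma invXp_le k m : (r m <= r k) = (k <= m)%N.
Proof.
rewrite lef_pV2 ?posrE ?exprn_gt0 ?ltr0n ?prime_gt0 //.
by rewrite ler_eXn2l // ltr1n prime_gt1.
Qed.

Lemma invXp_lt k m : (r m < r k) = (k < m)%N.
Proof. by rewrite ltNge invXp_le -ltnNge. Qed.

Lemma padic_abs_rat_nat_le (a k : nat) : (N a%:R <= r k) = (p ^ k %| a)%N.
Proof.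
have [->|a0] := posnP a.
  by rewrite padic_abs_rat0 dvdn0 ltW ?invXp_gt0.
have -> : (a%:R : rat) = (a%:Z)%:~R / 1%:~R by rewrite divr1.
rewrite padic_abs_rat_frac //; last by rewrite -lt0n.
rewrite logn1 sub0r pfactor_dvdn // -invr_expz absz_nat.
by rewrite -[_ ^ _]/(_ ^+ logn p a) invXp_le.
Qed.

Lemma padic_abs_rat_int_le (a : int) (k : nat) :
  (N a%:~R <= r k) = ((p ^ k)%N%:Z %| a)%Z.
Proof.
rewrite dvdzE absz_nat -padic_abs_rat_nat_le.
by case: (intP a) => [|n|n]; rewrite ?rmorphN ?padic_abs_ratN.
Qed.

Lemma padic_cauchy_cst (q : rat) : (fun=> q) \in padic_cauchy p_pr.
Proof.
by apply/padic_cauchyP => e e0; exists 0%N => m n _ _; rewrite subrr padic_abs_rat0.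
Qed.

Definition Qp_rat (q : rat) : Qp := Qp_of (PadicCseq (padic_cauchy_cst q)).

Lemma padic_abs_Qp_rat q : abs (Qp_rat q) = N q.
Proof. by apply: padic_abs_Qp_of_lim; apply: cvg_near_cst; exact: nearW. Qed.

Lemma Qp_ratB q s : Qp_rat (q - s) = Qp_rat q - Qp_rat s.
Proof. rewrite /Qp_rat -(rmorphB (@Qp_of p p_pr)); congr (Qp_of _).
exact: val_inj. Qed.

Lemma Qp_rat_nat (a : nat) : Qp_rat a%:R = a%:R.
Proof.
rewrite /Qp_rat -(rmorph_nat (@Qp_of p p_pr)); congr (Qp_of _); apply: val_inj.
rewrite [RHS](rmorph_nat (\val : {rmorphism padic_cseq p_pr -> (nat -> rat)})).
apply/funext => n; change (a%:R = (a%:R : nat -> rat) n).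
elim: a => // a IH; rewrite mulrSr [in RHS]mulrSr.
by change (a%:R + 1 = (a%:R : nat -> rat) n + 1); rewrite IH.
Qed.

Lemma padic_abs_nat_le (a k : nat) : (abs a%:R <= r k) = (p ^ k %| a)%N.
Proof. by rewrite -Qp_rat_nat padic_abs_Qp_rat padic_abs_rat_nat_le. Qed.

Lemma padic_absB x y : abs (x - y) = abs (y - x).
Proof. by rewrite -padic_absN opprB. Qed.

Lemma padic_abs_natB_le (a b k : nat) :
  (abs (a%:R - b%:R) <= r k) = (a == b %[mod p ^ k])%N.
Proof.
wlog ab : a b / (b <= a)%N.
  move=> h; case/orP: (leq_total b a) => /h // {}h.
  by rewrite padic_absB h eq_sym.
by rewrite -natrB // padic_abs_nat_le eqn_mod_dvd.
Qed.

Lemma padic_le_trans y x z (e : rat) :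
  abs (x - y) <= e -> abs (y - z) <= e -> abs (x - z) <= e.
Proof.
move=> xy yz; rewrite -[x - z](subrKA y); apply: (le_trans (padic_abs_ultra _ _)).
by rewrite ge_max xy.
Qed.

Lemma padic_abs_cauchy (s : padic_cseq p_pr) k :
  exists n, abs (Qp_of s - Qp_rat (s n)) <= r k.
Proof.
have [n ns] := padic_cauchyP p_pr _ (valP s) _ (invXp_gt0 k).
exists n; rewrite -[_ - _](rmorphB (@Qp_of p p_pr)).
apply: (cvgr_to_le (@padic_cseq_abs_cvg p p_pr _)).
exists n => // m /= nm; apply: ltW.
by have := ns m n nm (leqnn n).
Qed.

Lemma padic_integer_den q : N q <= 1 -> ~~ (p %| `|denq q|)%N.
Proof.
move=> q1; apply/negP => pd; have [q0|q0] := eqVneq q 0.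
  by move: pd; rewrite q0 dvdn1 => /eqP pE; have := prime_gt1 p_pr; rewrite pE.
have pn : ~~ (p %| `|numq q|)%N.
  apply/negP => pn; have := coprime_num_den q.
  by move/(coprime_dvdl pn)/(coprime_dvdr pd); rewrite /coprime gcdnn => /eqP pE;
    have := prime_gt1 p_pr; rewrite pE.
move: q1; rewrite /padic_abs_rat (negPf q0) leNgt => /negP; apply.
rewrite (@logn_coprime _ `|numq q|) ?prime_coprime // subr0.
rewrite exprn_egt1 ?ltr1n ?prime_gt1 // -lt0n logn_gt0 mem_primes p_pr pd andbT.
by rewrite absz_gt0 denq_neq0.
Qed.

(** The denominator of a [p]-integral rational is prime to [p], hence invertible modulo [p^k] by
    Bezout; [a] is the residue of numerator over denominator. *)
Lemma padic_rat_nat_approx q k : N q <= 1 -> exists a : nat, N (q - a%:R) <= r k.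
Proof.
move=> /padic_integer_den pd; have p0 := prime_gt0 p_pr.
have pk : (p ^ k)%N%:Z != 0 by rewrite eqz_nat -lt0n expn_gt0 p0.
have [c cP] : exists c : int, ((p ^ k)%N%:Z %| numq q - c * denq q)%Z.
  have /coprimezP[[u v] /= uv] : coprimez (denq q) (p ^ k)%N%:Z.
    by apply: coprimeXr; rewrite coprime_sym prime_coprime.
  exists (numq q * u); have -> : numq q - numq q * u * denq q =
      numq q * v * (p ^ k)%N%:Z.
    by rewrite -{1}[numq q]mulr1 -uv; ring.
  exact: dvdz_mull.
exists `|(c %% (p ^ k)%N%:Z)%Z|%N.
set a := `|_|%N; have aE : a%:Z = (c %% (p ^ k)%N%:Z)%Z.
  by rewrite gez0_abs ?modz_ge0.
have d0 : (denq q)%:~R != 0 :> rat by rewrite intr_eq0 denq_neq0.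
have -> : q - a%:R = (numq q - a%:Z * denq q)%:~R / (denq q)%:~R.
  by rewrite -{1}(divq_num_den q) rmorphB rmorphM /=; field.
rewrite padic_abs_ratM // padic_abs_ratV //.
have -> : N (denq q)%:~R = 1.
  rewrite -[_%:~R]divr1 -[X in _ / X]/(1%:~R) padic_abs_rat_frac ?denq_neq0 //.
  by rewrite logn1 (@logn_coprime _ `|denq q|) ?prime_coprime // subrr expr0z.
rewrite invr1 mulr1 padic_abs_rat_int_le.
have -> : numq q - a%:Z * denq q = numq q - c * denq q + (c - a%:Z) * denq q by ring.
rewrite rpredD // dvdz_mulr //.
by rewrite aE {1}(divz_eq c (p ^ k)%N%:Z) addrK dvdz_mull.
Qed.

(** Density of the naturals makes every level finite: together with [padic_abs_natB_le], it
    identifies the balls of radius [p^-k] in [Zp] with the residues modulo [p^k]. *)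
Lemma Zp_nat_approx x k : Zp p_pr x -> exists a : nat, abs (x - a%:R) <= r k.
Proof.
rewrite /Defs.Zp /= => x1; have [n] := padic_abs_cauchy (generic_quotient.repr x) k.
rewrite Qp_reprK; set q := generic_quotient.repr x n => xq.
have [|a qa] := @padic_rat_nat_approx q k.
  rewrite -padic_abs_Qp_rat -[Qp_rat q](subrK x).
  rewrite (le_trans (padic_abs_ultra _ _)) // ge_max x1 andbT padic_absB.
  apply: (le_trans xq); have := invXp_le 0 k; rewrite expr0 invr1 => ->.
  exact: leq0n.
exists a; apply: (padic_le_trans xq).
by rewrite -Qp_rat_nat -Qp_ratB padic_abs_Qp_rat.
Qed.

Lemma padic_abs_pow x : x != 0 -> exists k : int, abs x = p%:R ^ k.
Proof.
rewrite -{1}(Qp_reprK x) Qp_of_eq0 => /padic_cseq_abs_stable[e e0 [k sk]].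
have se : abs x = e.
  rewrite -(Qp_reprK x); apply: padic_abs_Qp_of_lim; apply: cvg_near_cst.
  by exists k => // n /= kn; rewrite sk.
have := sk k (leqnn k); rewrite se /padic_abs_rat; case: ifP => [_ eE|_ <-].
  by rewrite -eE ltxx in e0.
by eexists.
Qed.

(** Nonzero absolute values are integral powers of [p], so none lies strictly between two
    consecutive powers. Hence the distance to the centre is constant on the shell between two
    consecutive balls. *)
Lemma padic_abs_lt x k : abs x <= r k -> ~~ (abs x <= r k.+1) -> abs x = r k.
Proof.
have p1 : 1 < p%:R :> rat by rewrite ltr1n prime_gt1.
have [->|/padic_abs_pow[j ->]] := eqVneq x 0.
  by rewrite padic_abs0 [X in ~~ X]ltW ?invXp_gt0.
rewrite !exprnN !ler_eXz2l // => h1 h2; congr (_ ^ _); lia.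
Qed.

Lemma ZpxP x : Zpx p_pr x <-> abs x = 1.
Proof.
split=> [[x1 [y y1 xy]]|x1].
  apply/eqP; rewrite eq_le x1 /=.
  have := padic_absM x y; rewrite xy padic_abs1 => E.
  by rewrite E ler_piMr // padic_abs_ge0.
have x0 : x != 0 by rewrite -padic_abs_eq0 x1 oner_neq0.
split; first by rewrite /Defs.Zp /= x1.
exists x^-1; last by rewrite mulfV.
have := padic_absM x x^-1; rewrite mulfV // padic_abs1 x1 mul1r /Defs.Zp /= => <-.
exact: lexx.
Qed.

Lemma Zpx_nat (a : nat) : Zpx p_pr a%:R <-> coprime p a.
Proof.
have h0 := padic_abs_nat_le a 0; have h1 := padic_abs_nat_le a 1.
rewrite expn0 expr0 invr1 dvd1n in h0; rewrite expn1 expr1 in h1.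
rewrite prime_coprime // -h1; split=> [/ZpxP ->|a1].
  by rewrite -[X in X <= _]invr1 -[X in X^-1](expr0 p%:R) -[X in _ <= X^-1]expr1 invXp_le.
by apply/ZpxP; rewrite (@padic_abs_lt _ 0) ?expr0 ?invr1.
Qed.

Lemma Zpx_nearby x y : Zpx p_pr x -> abs (y - x) < 1 -> Zpx p_pr y.
Proof.
move=> /ZpxP x1 xy; apply/ZpxP/eqP; rewrite eq_le; apply/andP; split.
  by rewrite -[y](subrK x) (le_trans (padic_abs_ultra _ _)) // x1 ge_max lexx ltW.
rewrite leNgt; apply/negP => y1.
have := padic_abs_ultra y (x - y); rewrite addrC subrK x1 leNgt gt_max y1.
by rewrite padic_absB xy.
Qed.

Lemma padic_mul_close (x y x' y' : Qp) (e : rat) : abs x = 1 -> abs y' = 1 ->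
  abs (x - x') <= e -> abs (y - y') <= e -> abs (x * y - x' * y') <= e.
Proof.
move=> x1 y1 xe ye; have -> : x * y - x' * y' = x * (y - y') + (x - x') * y' by ring.
by rewrite (le_trans (padic_abs_ultra _ _)) // !padic_absM x1 y1 mul1r mulr1 ge_max ye.
Qed.

Lemma invXp_small (e : rat) : 0 < e -> exists k, r k < e.
Proof.
move=> e0; exists (Num.bound e^-1).
rewrite invf_plt ?posrE ?exprn_gt0 ?ltr0n ?prime_gt0 //.
apply: lt_le_trans (archi_boundP _) _; first by rewrite invr_ge0 ltW.
by rewrite -natrX ler_nat ltnW // ltn_expl // prime_gt1.
Qed.

Lemma padic_abs_dominant x y : abs x < abs y -> abs (x + y) = abs y.
Proof.
move=> xy; apply/eqP; rewrite eq_le; apply/andP; split.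
  by rewrite (le_trans (padic_abs_ultra _ _)) // ge_max lexx ltW.
rewrite leNgt; apply/negP => h; have := padic_abs_ultra (x + y) (- x).
by rewrite addrAC subrr add0r padic_absN leNgt gt_max h xy.
Qed.

(** Completeness of [Qp]. Its elements are classes of rational Cauchy sequences, so the limit has to
    be built from rationals: each centre is replaced with a natural number at distance at most the
    radius, which leaves the ball unchanged. *)
Lemma padic_nested (y : nat -> Qp) :
  (forall i, Zp p_pr (y i)) -> (forall i, abs (y i.+1 - y i) <= r i) ->
  exists z, forall i, abs (z - y i) <= r i.
Proof.
move=> yZ ys.
have ym i m : (i <= m)%N -> abs (y m - y i) <= r i.
  elim: m => [|m IH]; first by rewrite leqn0 => /eqP->; rewrite subrr padic_abs0 ltW ?invXp_gt0.
  rewrite leq_eqVlt => /orP[/eqP->|im].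
    by rewrite subrr padic_abs0 ltW ?invXp_gt0.
  by apply: (padic_le_trans (y := y m)); [apply: le_trans (ys m) _; rewrite invXp_le|exact: IH].
have /choice[a aP] : forall i, exists a : nat, abs (y i - a%:R) <= r i.
  by move=> i; exact: Zp_nat_approx.
have am i m : (i <= m)%N -> abs ((a m)%:R - (a i)%:R) <= r i.
  move=> im; have h1 : abs ((a m)%:R - y m) <= r i.
    by rewrite padic_absB (le_trans (aP m)) // invXp_le.
  exact: padic_le_trans (padic_le_trans h1 (ym i m im)) (aP i).
have aC : (fun i => (a i)%:R : rat) \in padic_cauchy p_pr.
  apply/padic_cauchyP => e e0.
  have [k ke] := invXp_small e0.
  exists k => m n km kn; apply: le_lt_trans ke.
  rewrite -padic_abs_Qp_rat Qp_ratB !Qp_rat_nat.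
  apply: (padic_le_trans (y := (a k)%:R)); first exact: am.
  by rewrite padic_absB am.
exists (Qp_of (PadicCseq aC)) => i.
apply: (padic_le_trans (y := (a i)%:R)); last by rewrite padic_absB.
rewrite -Qp_rat_nat /Qp_rat -(rmorphB (@Qp_of p p_pr)).
apply: (cvgr_to_le (@padic_cseq_abs_cvg p p_pr _)).
exists i => // m /= im; rewrite [X in N X](_ : _ = (a m)%:R - (a i)%:R) //.
by rewrite -padic_abs_Qp_rat Qp_ratB !Qp_rat_nat am.
Qed.

End PadicBalls.

(** * The quotient [(Z/p^n)^*] *)

(* The level is written [m.+1] because ['Z_n] is the ring of integers mod 2
   when [n <= 1]. *)
Section UnitQuotient.
Variables (p : nat) (p_pr : prime p) (m : nat).
Local Notation abs := (@padic_abs p p_pr).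
Local Notation r k := ((p%:R : rat) ^- k).
Local Notation q := (p ^ m.+1)%N.
Local Notation G := {unit 'Z_(p ^ m.+1)}.

Lemma pfactorS_gt1 : (1 < q)%N.
Proof. by rewrite -{1}(expn0 p) ltn_exp2l ?prime_gt1. Qed.

Lemma unit_lift_subproof (a : G) : ((\val a : nat)%:R : Qp p_pr) \in Zpx p_pr.
Proof.
apply/mem_set/Zpx_nat; have := valP a.
rewrite -[X in X \is a _]natr_Zp unitZpE ?pfactorS_gt1 //.
by rewrite coprime_pexpl.
Qed.

Definition unit_lift (a : G) : Zpx p_pr := exist (fun z => z \in Zpx p_pr) _ (unit_lift_subproof a).

Lemma unit_lift_inj a b :
  abs (\val (unit_lift a) - \val (unit_lift b)) <= r m.+1 -> a = b.
Proof.
rewrite padic_abs_natB_le => /eqP ab; apply: val_inj; apply: val_inj.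
have lt (c : G) : ((\val c : nat) < q)%N.
  by rewrite -[X in (_ < X)%N]Zp_cast ?pfactorS_gt1 // ltn_ord.
by rewrite !modn_small ?lt in ab.
Qed.

Lemma unit_proj_ex (x : Zpx p_pr) :
  exists a : G, abs (\val x - \val (unit_lift a)) <= r m.+1.
Proof.
have /set_mem xZ := valP x.
have [a xa] : exists a : nat, abs (\val x - a%:R) <= r m.+1.
  by apply: Zp_nat_approx; case: xZ.
have ca : coprime p a.
  apply/(Zpx_nat p_pr); apply: (Zpx_nearby xZ); rewrite padic_absB.
  apply: (le_lt_trans xa); have := invXp_lt p_pr 0 m.+1.
  by rewrite expr0 invr1 => ->.
have ua : (a%:R : 'Z_q) \is a GRing.unit.
  by rewrite unitZpE ?pfactorS_gt1 // coprime_pexpl.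
exists (FinRing.Unit ua); apply: (padic_le_trans xa).
by rewrite padic_abs_natB_le /= val_Zp_nat ?pfactorS_gt1 // modn_mod.
Qed.

(** The residue class of [x] modulo [p^(m+1)]; by [unit_lift_inj] the chosen value is the only
    possible one. *)
Definition unit_proj (x : Zpx p_pr) : G := projT1 (cid (unit_proj_ex x)).

Lemma unit_projP x : abs (\val x - \val (unit_lift (unit_proj x))) <= r m.+1.
Proof. exact: projT2 (cid (unit_proj_ex x)). Qed.

Lemma unit_proj_eq x y : (unit_proj x = unit_proj y) <-> abs (\val x - \val y) <= r m.+1.
Proof.
split=> [xy|xy].
  by apply: (padic_le_trans (unit_projP x)); rewrite xy padic_absB unit_projP.
apply: unit_lift_inj; apply: padic_le_trans (unit_projP y).
by apply: padic_le_trans xy; rewrite padic_absB unit_projP.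
Qed.

Lemma unit_liftK : cancel unit_lift unit_proj.
Proof. by move=> a; apply: unit_lift_inj; rewrite padic_absB unit_projP. Qed.

Lemma Zpx_abs (x : Zpx p_pr) : abs (\val x) = 1.
Proof. by apply/ZpxP; exact: set_mem (valP x). Qed.

Lemma unit_projM x y : unit_proj (Zpx_mul x y) = (unit_proj x * unit_proj y)%g.
Proof.
apply: unit_lift_inj.
apply: (padic_le_trans (y := \val (Zpx_mul x y))); first by rewrite padic_absB unit_projP.
apply: (padic_le_trans (y := \val (unit_lift (unit_proj x)) * \val (unit_lift (unit_proj y)))).
  by apply: padic_mul_close; rewrite ?Zpx_abs ?unit_projP.
rewrite -natrM padic_abs_natB_le.
set a := \val (unit_proj x); set b := \val (unit_proj y).
change (a * b == ((a * b) %% (Zp_trunc q).+2) %[mod q])%N.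
by move: (nat_of_ord a) (nat_of_ord b) => u v; rewrite Zp_cast ?pfactorS_gt1 // modn_mod.
Qed.

Lemma card_unit_quotient : #|{: G}| = (p.-1 * p ^ m)%N.
Proof.
rewrite -cardsT -[LHS]/(#|units_Zp q|) card_units_Zp ?expn_gt0 ?prime_gt0 //.
by rewrite totient_pfactor.
Qed.

End UnitQuotient.

Arguments unit_lift : simpl never.

(** * Haar measure of balls and averages *)

Section HaarMeasure.
Variables (R : realType) (p : nat) (p_pr : prime p).
Variable mu : {measure set (borelQp p_pr) -> \bar R}.
Hypothesis mu_haar : is_haar mu.
Local Notation abs := (@padic_abs p p_pr).
Local Notation T := (borelQp p_pr).
Local Notation r k := ((p%:R : rat) ^- k).

Definition pball k (x : Qp p_pr) : set T := [set z : Qp p_pr | abs (z - x) <= r k].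

Lemma pball_eq k x y : abs (x - y) <= r k -> pball k x = pball k y.
Proof.
move=> xy; apply/seteqP; split=> z /= zx; first exact: padic_le_trans xy.
by apply: padic_le_trans zx _; rewrite padic_absB.
Qed.

Lemma open_pball k x : open (pball k x : set (Qp p_pr)).
Proof.
rewrite openE => z zx; apply/nbhs_ballP; exists (r k); first exact: invXp_gt0.
move=> y zy /=; apply: padic_le_trans zx; rewrite padic_absB; exact: ltW.
Qed.

Lemma measurable_open_Qp (A : set T) : open (A : set (Qp p_pr)) -> measurable A.
Proof. by move=> oA; apply: sub_sigma_algebra; exact: oA. Qed.

Lemma measurable_pball k x : measurable (pball k x).
Proof. by apply: measurable_open_Qp; exact: open_pball. Qed.

Lemma Zp_pball0 : Zp p_pr = pball 0 0.
Proof. by apply/seteqP; split=> z; rewrite /= /pball /Defs.Zp /= subr0 expr0 invr1. Qed.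

Lemma measurable_Zp : measurable (Zp p_pr : set T).
Proof. by rewrite Zp_pball0; exact: measurable_pball. Qed.

Lemma measurable_Zpx : measurable (Zpx p_pr : set T).
Proof.
apply: measurable_open_Qp; rewrite openE => x xZ; apply/nbhs_ballP; exists 1 => //.
by move=> y xy; apply: (Zpx_nearby xZ); rewrite padic_absB; exact: xy.
Qed.

Lemma integrable_cst_Zp (A : set T) (c : R) : measurable A -> A `<=` Zp p_pr ->
  mu.-integrable A (EFin \o cst c).
Proof.
move=> mA AZ; apply/integrableP; split; first by apply/measurable_EFinP; exact: measurable_cst.
rewrite /= integral_cst // lte_mul_pinfty //.
apply: (@le_lt_trans _ _ (mu (Zp p_pr))); last by rewrite mu_haar.2 ltry.
by apply: le_measure => //; rewrite inE //; exact: measurable_Zp.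
Qed.

Lemma Rintegral_partition (I : finType) (P : pred I) (F : I -> set T)
    (D : set T) (f : T -> R) :
  measurable D -> (forall i, measurable (F i)) ->
  (forall i j z, P i -> P j -> F i z -> F j z -> i = j) ->
  (forall z, D z <-> exists2 i, P i & F i z) ->
  mu.-integrable D (EFin \o f) ->
  \int[mu]_(z in D) f z = \sum_(i | P i) \int[mu]_(z in F i) f z.
Proof.
move=> mD mF FI DE fi.
have DU : D = \big[setU/set0]_(i <- enum P) F i.
  rewrite -bigcup_seq; apply/seteqP; split=> z.
    by move/DE => [i Pi Fz]; exists i => //=; rewrite mem_enum.
  by move=> [i /=]; rewrite mem_enum => Pi Fz; apply/DE; exists i.
have FD i : P i -> F i `<=` D by move=> Pi z Fz; apply/DE; exists i.
rewrite /Rintegral {1}DU integral_bigsetU_EFin ?enum_uniq //; last first.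
- by rewrite -DU; apply: measurable_int fi.
- move=> i j /=; rewrite !mem_enum => Pi Pj [z [Fi Fj]]; exact: FI Fi Fj.
rewrite big_enum /= -sum_fine // => i Pi; apply: integrable_fin_num => //.
by apply: integrableS fi => //; exact: FD.
Qed.

Lemma mu_pball_center k x : mu (pball k x) = mu (pball k 0).
Proof.
rewrite -(mu_haar.1 x (pball k 0)); last exact: measurable_pball.
congr (mu _); apply/seteqP; split=> z /=.
  rewrite /pball /= => zx; exists ((z : Qp p_pr) - x); first by rewrite /= subr0.
  by rewrite addrC subrK.
by move=> [y + <-]; rewrite /pball /= subr0 addrAC subrr add0r.
Qed.

Lemma pball_sub_Zp k x : Zp p_pr x -> pball k x `<=` Zp p_pr.
Proof.
move=> x1 z zx; rewrite /Defs.Zp /= -(subrK x z) (le_trans (padic_abs_ultra _ _)) //.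
rewrite ge_max x1 andbT (le_trans zx) //; have := invXp_le p_pr 0 k.
by rewrite expr0 invr1 => ->.
Qed.

Lemma Zp_nat (a : nat) : Zp p_pr a%:R.
Proof.
have := padic_abs_nat_le p_pr a 0; rewrite /Defs.Zp /= expr0 invr1 => ->.
by rewrite expn0 dvd1n.
Qed.

(** [Zp] has measure 1 and is the disjoint union of the [p^k] balls centred at the residues, which
    are translates of each other. *)
Lemma mu_pball k x : fine (mu (pball k x)) = p%:R ^- k.
Proof.
rewrite mu_pball_center.
have pk0 : (p%:R ^+ k : R) != 0 by rewrite expf_neq0 // pnatr_eq0 -lt0n prime_gt0.
(* The factors 1 turn both sides into integrals of a constant, to which [Rintegral_partition]
   applies. *)
suff : 1 * fine (mu (Zp p_pr)) = \sum_(a < p ^ k) 1 * fine (mu (pball k 0)).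
  rewrite mu_haar.2 /= mulr1 mul1r sumr_const card_ord -[_ *+ _]mulr_natl natrX.
  by move=> /(congr1 ( *%R (p%:R ^- k))); rewrite mulr1 mulKf.
rewrite -Rintegral_cst; last exact: measurable_Zp.
rewrite (Rintegral_partition (P := xpredT) (F := fun a : 'I_(p ^ k) => pball k a%:R)).
- apply: eq_bigr => a _; rewrite Rintegral_cst ?mu_pball_center //.
  exact: measurable_pball.
- exact: measurable_Zp.
- by move=> i; exact: measurable_pball.
- move=> i j z _ _ iz jz; apply: ord_inj; apply/eqP.
  have : abs ((i : nat)%:R - (j : nat)%:R) <= r k.
    by apply: padic_le_trans jz; rewrite padic_absB.
  by rewrite padic_abs_natB_le !modn_small.
- move=> z; split=> [/(@Zp_nat_approx _ _ _ k)[a za]|[i _]]; last first.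
    by apply: pball_sub_Zp; exact: Zp_nat.
  have pk : (0 < p ^ k)%N by rewrite expn_gt0 prime_gt0.
  exists (Ordinal (ltn_pmod a pk)) => //=; apply: (padic_le_trans za).
  by rewrite padic_abs_natB_le modn_mod.
- by apply: integrable_cst_Zp => //; exact: measurable_Zp.
Qed.

(* For [k = 0] this is [Z_p^*] and not [Z_p]. *)
Definition wball k (x : Zpx p_pr) : set T := Zpx p_pr `&` pball k (\val x).

Lemma wball0 x : wball 0 x = Zpx p_pr.
Proof.
apply/setIidPl => z [z1 _]; rewrite /pball /= expr0 invr1 (le_trans (padic_abs_ultra _ _)) //.
by rewrite padic_absN ge_max z1 Zpx_abs lexx.
Qed.

Lemma wballS k x : wball k.+1 x = pball k.+1 (\val x).
Proof.
apply/setIidPr => z zx; apply: (Zpx_nearby (set_mem (valP x))).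
apply: (le_lt_trans zx); have := invXp_lt p_pr 0 k.+1.
by rewrite expr0 invr1 => ->.
Qed.

Lemma measurable_wball k x : measurable (wball k x).
Proof. by apply: measurableI; [exact: measurable_Zpx|exact: measurable_pball]. Qed.

Lemma wball_sub k m x : (k <= m)%N -> wball m x `<=` wball k x.
Proof. by move=> km z [zZ zx]; split=> //; apply: le_trans zx _; rewrite invXp_le. Qed.

Lemma wball_eq k x y : abs (\val x - \val y) <= r k -> wball k x = wball k y.
Proof. by move=> xy; rewrite /wball (pball_eq xy). Qed.

Lemma integrable_cst_wball k x (c : R) : mu.-integrable (wball k x) (EFin \o cst c).
Proof.
by apply: integrable_cst_Zp; [exact: measurable_wball|move=> z [[]]].
Qed.

Local Notation G m := {unit 'Z_(p ^ m.+1)}.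

Lemma Rintegral_wball_split (f : T -> R) k m x : (k <= m.+1)%N ->
  mu.-integrable (Zpx p_pr) (EFin \o f) ->
  \int[mu]_(z in wball k x) f z =
  \sum_(a : G m | abs (\val (unit_lift p_pr a) - \val x) <= r k)
     \int[mu]_(z in wball m.+1 (unit_lift p_pr a)) f z.
Proof.
move=> km fi; apply: Rintegral_partition.
- exact: measurable_wball.
- by move=> a; exact: measurable_wball.
- move=> a b z _ _ [_ az] [_ bz]; apply: unit_lift_inj.
  by apply: padic_le_trans bz; rewrite padic_absB.
- move=> z; split=> [[zZ zx]|[a ax [zZ za]]].
    pose z' : Zpx p_pr := exist (fun z => z \in Zpx p_pr) z (mem_set zZ).
    have zz := unit_projP m z'.
    exists (unit_proj m z') => //; apply: padic_le_trans zx.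
    by rewrite padic_absB (le_trans zz) // invXp_le.
  by split=> //; apply: padic_le_trans ax; apply: le_trans za _; rewrite invXp_le.
- apply: integrableS fi; [exact: measurable_Zpx|exact: measurable_wball|].
  by move=> z [].
Qed.

(** Volume of a ball of level [k]. Level 0 is [Zp] without [p Zp], of measure [1 - 1/p]; this
    exceptional value enters the constant term of [lambda]. *)
Definition wvol k : R := if k is 0 then p.-1%:R / p%:R else p%:R ^- k.

Lemma wvol_gt0 k : 0 < wvol k.
Proof.
have p0 : 0 < (p%:R : R) by rewrite ltr0n prime_gt0.
case: k => [|k]; last by rewrite invr_gt0 exprn_gt0.
by rewrite divr_gt0 // ltr0n -subn1 subn_gt0 prime_gt1.
Qed.

Lemma integrable_cst_Zpx (c : R) : mu.-integrable (Zpx p_pr) (EFin \o cst c).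
Proof. by apply: integrable_cst_Zp; [exact: measurable_Zpx|move=> z []]. Qed.

Lemma mu_wball k x : fine (mu (wball k x)) = wvol k.
Proof.
case: k => [|k]; last by rewrite wballS mu_pball.
rewrite -[LHS]mul1r -Rintegral_cst; last exact: measurable_wball.
rewrite (@Rintegral_wball_split (cst 1) 0 0 x isT (integrable_cst_Zpx 1)).
rewrite (eq_bigl xpredT) => [|a]; last first.
  rewrite expr0 invr1 (le_trans (padic_abs_ultra _ _)) //.
  by rewrite padic_absN ge_max !Zpx_abs lexx.
rewrite (eq_bigr (fun=> p%:R ^- 1)) => [|a _]; last first.
  by rewrite Rintegral_cst ?mul1r wballS ?mu_pball //; exact: measurable_pball.
by rewrite sumr_const (card_unit_quotient p_pr) expn0 muln1 -[LHS]mulr_natl expr1.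
Qed.

Definition wavg (f : T -> R) k (x : Zpx p_pr) : R :=
  (\int[mu]_(z in wball k x) f z) / wvol k.

Lemma wavg_eq f k x y : abs (\val x - \val y) <= r k -> wavg f k x = wavg f k y.
Proof. by move=> xy; rewrite /wavg (wball_eq xy). Qed.

(** The martingale property of ball averages: the balls of level [k.+1] inside [wball k x] partition
    it and have equal volume, so their averages have mean [wavg f k x]. *)
Lemma wavg_children f k x : mu.-integrable (Zpx p_pr) (EFin \o f) ->
  \sum_(a : G k | abs (\val (unit_lift p_pr a) - \val x) <= r k)
     (wavg f k.+1 (unit_lift p_pr a) - wavg f k x) = 0.
Proof.
move=> fi; rewrite sumrB -mulr_suml -Rintegral_wball_split //.
have w0 := wvol_gt0 k; have w1 := wvol_gt0 k.+1.
(* Splitting the integral of the constant 1 gives the number of children as a quotient of volumes,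
   for [k = 0] and [k > 0] alike. *)
have : 1 * wvol k = \sum_(a : G k | abs (\val (unit_lift p_pr a) - \val x) <= r k) 1 * wvol k.+1.
  rewrite -(mu_wball k x) -Rintegral_cst; last exact: measurable_wball.
  rewrite (@Rintegral_wball_split (cst 1) k k x (leqnSn k) (integrable_cst_Zpx 1)).
  apply: eq_bigr => a _.
  by rewrite Rintegral_cst ?mu_wball //; exact: measurable_wball.
rewrite !mul1r !sumr_const -(mulr_natl (wvol k.+1)) -(mulr_natl (wavg f k x)) => E; rewrite /wavg E.
have n0 : (#|[pred i : G k | abs (\val (unit_lift p_pr i) - \val x) <= r k]|%:R : R) != 0.
  by apply: contraTneq w0 => n0; rewrite E n0 mul0r ltxx.
by field; rewrite n0 lt0r_neq0.
Qed.

End HaarMeasure.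

(** * Summation over shells *)

Section ShellSum.
Variables (R : realType) (p : nat) (p_pr : prime p).
Variable mu : {measure set (borelQp p_pr) -> \bar R}.
Hypothesis mu_haar : is_haar mu.
Local Notation abs := (@padic_abs p p_pr).
Local Notation T := (borelQp p_pr).
Local Notation r k := ((p%:R : rat) ^- k).
Local Notation A := (wavg mu).

Lemma lambdaS (K : numFieldType) k :
  lambda K p k.+1 = - p%:R ^+ k - p%:R ^+ k / p%:R + 2 / p%:R.
Proof.
have p0 : (p%:R : K) != 0 by rewrite pnatr_eq0 -lt0n prime_gt0.
have -> : lambda K p k.+1 = - p%:R ^ (k%:Z + 1 - 1) - p%:R ^ (k%:Z + 1 - 2) + 2 / p%:R.
  by rewrite /lambda -addn1 PoszD.
by rewrite addrK (_ : k%:Z + 1 - 2 = k%:Z + (-1)) ?expfzDr // -addrA.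
Qed.

Lemma ratr_invXp k : ratr (r k) = p%:R ^- k :> R.
Proof. by rewrite fmorphV rmorphXn /= ratr_nat. Qed.

Definition kern (g : T -> R) (x : Zpx p_pr) (z : T) : R :=
  (g z - g (\val x)) / ratr (abs ((z : Qp p_pr) - \val x) ^+ 2).

Lemma measurable_dist2 (x : Zpx p_pr) :
  measurable_fun (Zpx p_pr : set T)
    (fun z : T => ratr (abs ((z : Qp p_pr) - \val x) ^+ 2) : R).
Proof.
move=> mD; apply: (measurability _ (RGenOInfty.measurableE R)); last exact: mD.
move=> _ [_ [y ->] <-]; apply: measurableI; first exact: mD.
apply: measurable_open_Qp.
rewrite openE => z; rewrite /= in_itv /= andbT => yz; apply/nbhs_ballP.
(* The set where the squared distance exceeds [y] is open: at [z = x] the value is 0, so [y < 0] and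
   every point belongs to it; elsewhere the distance is locally constant. *)
have [zx|zx] := eqVneq (z : Qp p_pr) (\val x).
  exists 1 => // t _ /=; rewrite in_itv /= andbT.
  move: yz; rewrite zx subrr padic_abs0 expr0n /= rmorph0 => /lt_le_trans; apply.
  by rewrite ler0q exprn_ge0 // padic_abs_ge0.
exists (abs ((z : Qp p_pr) - \val x)).
  by rewrite /= lt_neqAle padic_abs_ge0 eq_sym padic_abs_eq0 subr_eq0 zx.
move=> t zt /=; rewrite in_itv /= andbT -[_ - sval x](subrKA (z : Qp p_pr)).
by rewrite padic_abs_dominant // padic_absB.
Qed.

Lemma integrable_scale (D : set T) (f : T -> R) (c : R) : measurable D ->
  mu.-integrable D (EFin \o f) -> mu.-integrable D (EFin \o (fun z => c * f z)).
Proof.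
move=> mD fi; apply: eq_integrable (integrableZl mD c fi) => // z _.
Qed.

Lemma Rintegral_setD (f : T -> R) (B C : set T) : measurable B -> measurable C ->
  C `<=` B -> mu.-integrable B (EFin \o f) ->
  \int[mu]_(z in B) f z = \int[mu]_(z in B `\` C) f z + \int[mu]_(z in C) f z.
Proof.
move=> mB mC CB fi; rewrite -Rintegral_setU; first by rewrite setUC setDUK.
- exact: measurableD.
- exact: mC.
- by rewrite setUC setDUK.
- by rewrite disj_set2E setDE -setIA setICl setI0.
Qed.

(** Dominated convergence with bound [|F|]: a point other than [x] leaves the balls from some level
    on, and at [x] itself [F] is 0. *)
Lemma wball_integral_cvg0 (F : T -> R) (x : Zpx p_pr) :
  mu.-integrable (Zpx p_pr) (EFin \o F) -> F (\val x) = 0 ->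
  \int[mu]_(z in wball k x) `|F z| @[k --> \oo] --> (0 : R).
Proof.
move=> Fi F0.
have mZ : measurable (Zpx p_pr : set T) by exact: measurable_Zpx.
pose f_ k : T -> \bar R := (EFin \o (Num.norm \o F)) \_ (wball k x).
have aF : mu.-integrable (Zpx p_pr) (EFin \o (Num.norm \o F)) by exact: integrable_abse Fi.
have f_m k : measurable_fun (Zpx p_pr : set T) (f_ k).
  apply: (iffLR (measurable_restrict _ (measurable_wball k x) mZ)).
  apply: (measurable_funS mZ); first by move=> z [].
  exact: measurable_int aF.
have [|||| _ _] := @dominated_convergence _ _ _ mu _ mZ f_ (cst 0%E) (EFin \o (Num.norm \o F)) f_m.
- exact: measurable_cst.
- apply: aeW => z zZ; apply: cvg_near_cst.
  have [zx|zx] := eqVneq (z : Qp p_pr) (\val x).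
    by apply: nearW => k; rewrite /f_ patchE; case: ifP => //= _; rewrite zx F0 normr0.
  have : 0 < abs ((z : Qp p_pr) - \val x).
    by rewrite lt_neqAle padic_abs_ge0 eq_sym padic_abs_eq0 subr_eq0 zx.
  move=> /(invXp_small p_pr)[k0 k0P]; exists k0 => // k /= kk0.
  rewrite /f_ patchE; case: ifPn => // /set_mem[_ zk].
  have := le_lt_trans (le_trans zk (_ : r k <= r k0)) k0P.
  by rewrite invXp_le // ltxx => /(_ kk0).
- exact: aF.
- apply: aeW => z k zZ; rewrite /f_ patchE; case: ifPn => _ /=.
    by rewrite lee_fin normr_id.
  by rewrite normr0 lee_fin.
rewrite integral0 => /fine_cvg; apply: cvg_trans; apply: near_eq_cvg; apply: nearW => k.
rewrite /= /Rintegral /f_ -integral_mkcondr; congr fine; congr (integral _ _ _).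
by apply/setIidPr => z [].
Qed.

Lemma kern_bound (g : T -> R) x k z : wball k x z ->
  p%:R ^+ k ^+ 2 * `|g z - g (\val x)| <= `|kern g x z|.
Proof.
move=> [zZ zk]; rewrite /kern normrM normfV.
have [zx|zx] := eqVneq (z : Qp p_pr) (\val x).
  by rewrite zx subrr normr0 mulr0 mul0r.
have d0 : 0 < abs ((z : Qp p_pr) - \val x).
  by rewrite lt_neqAle padic_abs_ge0 eq_sym padic_abs_eq0 subr_eq0 zx.
rewrite mulrC ler_wpM2l // ger0_norm; last by rewrite ler0q exprn_ge0 // ltW.
rewrite -[leLHS]invrK lef_pV2 ?posrE; last 2 first.
- by rewrite invr_gt0 !exprn_gt0 // ltr0n prime_gt0.
- by rewrite ltr0q exprn_gt0.
rewrite (_ : _^-1 = ratr ((r k) ^+ 2)); last by rewrite rmorphXn /= ratr_invXp exprVn.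
by rewrite ler_rat lerXn2r ?nnegrE ?(ltW d0) // ltW // invXp_gt0.
Qed.

Lemma kern_shell (g : T -> R) x k z : wball k x z -> ~ wball k.+1 x z ->
  kern g x z = p%:R ^+ k ^+ 2 * (g z - g (\val x)).
Proof.
move=> [zZ zk] zNk; rewrite /kern (@padic_abs_lt _ _ _ k zk); last first.
  by apply/negP => zk1; apply: zNk.
by rewrite rmorphXn /= ratr_invXp exprVn invrK mulrC.
Qed.

Section Fixed.
Variables (g : T -> R) (x : Zpx p_pr).
Local Notation F := (kern g x).
Local Notation c := (g (\val x)).
Hypothesis Fi : mu.-integrable (Zpx p_pr) (EFin \o F).

(** The domain of [D0] speaks of the kernel only. Multiplying the kernel by the squared distance,
    which is at most 1 between units, gives back [g - c]. *)
Lemma kern_integrable : mu.-integrable (Zpx p_pr) (EFin \o g).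
Proof.
have mZ : measurable (Zpx p_pr : set T) by exact: measurable_Zpx.
have hE z : g z = F z * ratr (abs ((z : Qp p_pr) - \val x) ^+ 2) + c.
  have [zx|zx] := eqVneq (z : Qp p_pr) (\val x).
    by rewrite zx subrr padic_abs0 expr0n /= rmorph0 mulr0 add0r.
  rewrite /kern mulfVK ?subrK // fmorph_eq0 expf_neq0 //.
  by rewrite padic_abs_eq0 subr_eq0.
have hi : mu.-integrable (Zpx p_pr)
    (EFin \o (fun z : T => F z * ratr (abs ((z : Qp p_pr) - \val x) ^+ 2))).
  apply: (le_integrable mZ _ _ Fi).
    apply/measurable_EFinP; apply: measurable_funM; last exact: measurable_dist2.
    by apply/measurable_EFinP; exact: measurable_int Fi.
  move=> z zZ; rewrite /= lee_fin normrM ler_piMr // ger0_norm.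
    rewrite -(rmorph1 (@ratr R)) ler_rat exprn_ile1 ?padic_abs_ge0 //.
    rewrite (le_trans (padic_abs_ultra _ _)) // padic_absN Zpx_abs ge_max lexx andbT.
    by have /ZpxP -> := zZ.
  by rewrite ler0q exprn_ge0 // padic_abs_ge0.
have -> : EFin \o g = ((EFin \o (fun z : T => F z * ratr (abs ((z : Qp p_pr) - \val x) ^+ 2))%R)
    \+ (EFin \o cst c))%E.
  by apply/funext => z /=; rewrite -EFinD -hE.
by apply: integrableD => //; exact: integrable_cst_Zpx.
Qed.

Lemma integrable_wball (f : T -> R) k : mu.-integrable (Zpx p_pr) (EFin \o f) ->
  mu.-integrable (wball k x) (EFin \o f).
Proof.
apply: integrableS; [exact: measurable_Zpx|exact: measurable_wball|by move=> z []].
Qed.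

Local Notation a k := (A g k x - c).

Lemma Rintegral_dev k : \int[mu]_(z in wball k x) (g z - c) = wvol R p k * a k.
Proof.
rewrite RintegralB; [|exact: measurable_wball|exact: integrable_wball kern_integrable
  |exact: integrable_cst_wball].
rewrite Rintegral_cst ?mu_wball //; last exact: measurable_wball.
by rewrite /wavg mulrBr mulrCA divff ?mulr1 1?mulrC // lt0r_neq0 // wvol_gt0.
Qed.

Lemma dev_integrable k : mu.-integrable (wball k x) (EFin \o (fun z => g z - c)).
Proof.
have := integrableB (measurable_wball k x) (integrable_wball k kern_integrable)
  (integrable_cst_wball mu_haar k x c).
by congr integrable.
Qed.

(** On this ball the kernel is at least [p^(2k+2)] times the deviation, while the volume is only
    [p^-(k+1)]. The power of [p] gained absorbs the boundary term of [shell_sum]. *)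
Lemma dev_bound k : p%:R ^+ k.+1 * `|a k.+1| <= \int[mu]_(z in wball k.+1 x) `|F z|.
Proof.
have mW := measurable_wball k.+1 x.
have p0 : 0 < (p%:R ^+ k.+1 : R) by rewrite exprn_gt0 // ltr0n prime_gt0.
have := le_normr_Rintegral mW (dev_integrable k.+1).
rewrite Rintegral_dev normrM (gtr0_norm (@wvol_gt0 R p p_pr _)) -(ler_pM2l (exprn_gt0 2 p0)).
rewrite mulrA /wvol expr2 mulfK ?lt0r_neq0 // => /le_trans; apply.
rewrite -RintegralZl //; last exact: integrable_abse (dev_integrable k.+1).
apply: le_Rintegral => //.
- by apply: integrable_scale => //; exact: integrable_abse (dev_integrable k.+1).
- exact: integrable_abse (integrable_wball k.+1 Fi).
- by move=> z zk; rewrite -expr2; exact: kern_bound.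
Qed.

Lemma shell_telescope k :
  \int[mu]_(z in wball k x) F z - \int[mu]_(z in wball k.+1 x) F z =
  p%:R ^+ k ^+ 2 * (wvol R p k * a k - wvol R p k.+1 * a k.+1).
Proof.
have mW j := measurable_wball j x; have sub := wball_sub (leqnSn k) (x := x).
rewrite (Rintegral_setD (mW k) (mW k.+1) sub (integrable_wball k Fi)) addrK.
rewrite -!Rintegral_dev (Rintegral_setD (mW k) (mW k.+1) sub (dev_integrable k)) addrK.
rewrite -RintegralZl; [|exact: measurableD|]; last first.
  apply: integrableS (dev_integrable k); [exact: mW|exact: measurableD|by move=> z []].
by apply: eq_Rintegral => z /set_mem[zk zNk]; exact: kern_shell.
Qed.

(* Abel summation: the coefficients of the deviations [a n] telescope to
   [lambda]. *)
Lemma shell_sum k :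
  \sum_(n < k.+1) lambda R p n.+1 * (A g n.+1 x - A g n x) =
  \int[mu]_(z in Zpx p_pr) F z - \int[mu]_(z in wball k.+1 x) F z
  + (lambda R p k.+1 + p%:R ^+ k / p%:R) * a k.+1.
Proof.
have p0 : (p%:R : R) != 0 by rewrite pnatr_eq0 -lt0n prime_gt0.
elim: k => [|k IH].
  rewrite big_ord1 -{1}(wball0 x) shell_telescope lambdaS.
  rewrite /wvol !expr0 expr1n expr1 mul1r -subn1 natrB ?prime_gt0 //.
  by field.
rewrite big_ord_recr /= IH.
have -> : \int[mu]_(z in wball k.+1 x) F z = \int[mu]_(z in wball k.+2 x) F z +
  (\int[mu]_(z in wball k.+1 x) F z - \int[mu]_(z in wball k.+2 x) F z) by ring.
have E1 : p%:R ^+ k.+1 = p%:R * p%:R ^+ k :> R by rewrite exprS.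
have E2 : p%:R ^+ k.+2 = p%:R * (p%:R * p%:R ^+ k) :> R by rewrite !exprS.
rewrite shell_telescope !lambdaS /wvol E2 E1.
have pk0 : (p%:R ^+ k : R) != 0 by rewrite expf_neq0.
by field; rewrite p0 pk0.
Qed.

Let ball_tail k : R := \int[mu]_(z in wball k x) `|F z|.

Let ball_tail_cvg : ball_tail k.+1 @[k --> \oo] --> 0.
Proof.
rewrite (@cvg_shiftS _ ball_tail).
by apply: wball_integral_cvg0 => //; rewrite /kern subrr mul0r.
Qed.

Lemma wavg_cvg : A g k x @[k --> \oo] --> c.
Proof.
rewrite -(@cvg_shiftS _ (fun k => A g k x)) /=; apply/subr_cvg0; apply/norm_cvg0P.
apply: (squeeze_cvgr _ (cvg_cst _) ball_tail_cvg); apply: nearW => k.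
rewrite normr_ge0 /=; apply: le_trans (dev_bound k).
by rewrite ler_peMl // exprn_ege1 // ler1n prime_gt0.
Qed.

Lemma shell_sum_cvg :
  \sum_(n < k) lambda R p n.+1 * (A g n.+1 x - A g n x) @[k --> \oo] -->
  \int[mu]_(z in Zpx p_pr) F z.
Proof.
rewrite -(@cvg_shiftS _ (fun k => \sum_(n < k) lambda R p n.+1 * (A g n.+1 x - A g n x))) /=.
apply/subr_cvg0; apply/norm_cvg0P.
(* The integral over the remaining ball contributes at most one [ball_tail] and the boundary term at
   most three; 5 leaves slack. *)
have cvg5 : 5 * ball_tail k.+1 @[k --> \oo] --> 0.
  by rewrite -[X in _ --> X](mulr0 5); apply: cvgMr; exact: ball_tail_cvg.
apply: (squeeze_cvgr _ (cvg_cst _) cvg5); apply: nearW => k.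
rewrite normr_ge0 /= shell_sum addrAC [X in `|X|](_ : _ =
  - (\int[mu]_(z in wball k.+1 x) F z) +
  (lambda R p k.+1 + p%:R ^+ k / p%:R) * a k.+1); last by ring.
apply: (le_trans (ler_normD _ _)); rewrite normrN.
have h1 := le_normr_Rintegral (measurable_wball k.+1 x) (integrable_wball k.+1 Fi).
have p0 : 0 < (p%:R : R) by rewrite ltr0n prime_gt0.
have p1 : 1 <= (p%:R : R) by rewrite ler1n prime_gt0.
have pk : 1 <= (p%:R ^+ k : R) by rewrite exprn_ege1.
have -> : lambda R p k.+1 + p%:R ^+ k / p%:R = - p%:R ^+ k + 2 / p%:R.
  by rewrite lambdaS; ring.
have h2 : `|- p%:R ^+ k + 2 / p%:R| <= 3 * p%:R ^+ k.+1 :> R.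
  have v1 : p%:R^-1 <= (1 : R) by rewrite invf_le1.
  have v0 : 0 <= (p%:R^-1 : R) by rewrite invr_ge0 ltW.
  have pk1 : p%:R ^+ k <= (p%:R ^+ k.+1 : R) by rewrite exprS ler_peMl // ltW // exprn_gt0.
  by rewrite ler_norml; apply/andP; split; lra.
have h3 := dev_bound k.
rewrite normrM; have : `|- p%:R ^+ k + 2 / p%:R| * `|a k.+1| <= 3 * ball_tail k.+1.
  apply: le_trans (_ : 3 * p%:R ^+ k.+1 * `|a k.+1| <= _); first exact: ler_wpM2r.
  by rewrite -mulrA ler_wpM2l.
have : 0 <= ball_tail k.+1 by apply: Rintegral_ge0.
rewrite /ball_tail in h1 h3 *; lra.
Qed.

End Fixed.
End ShellSum.

(** * Martingales for the filtration by balls *)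

Section NestedBalls.
Variables (R : realType) (p : nat) (p_pr : prime p).
Local Notation abs := (@padic_abs p p_pr).
Local Notation r k := ((p%:R : rat) ^- k).
Local Notation G m := {unit 'Z_(p ^ m.+1)}.

(** Adaptedness to the filtration by balls, and the martingale identity. The children of a ball have
    equal volume, so conditional expectation is an unweighted mean and no measure enters. *)
Definition ball_martingale (S : nat -> Zpx p_pr -> R) :=
  (forall k (x y : Zpx p_pr), abs (\val x - \val y) <= r k -> S k x = S k y) /\
  (forall k (x : Zpx p_pr), \sum_(a : G k | abs (\val (unit_lift p_pr a) - \val x) <= r k)
     (S k.+1 (unit_lift p_pr a) - S k x) = 0).

Lemma ball_martingale_le0 S : ball_martingale S ->
  (forall x, S k x @[k --> \oo] --> 0) -> forall k x, S k x <= 0.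
Proof.
move=> [Sinv Schild] Slim k0 x0; rewrite leNgt; apply/negP => c0.
have step k (x : Zpx p_pr) : exists y : Zpx p_pr, abs (\val y - \val x) <= r k /\ S k x <= S k.+1 y.
  (* If every child had a strictly smaller value, all the terms of the vanishing sum would be
     negative, and there is at least one term, the child that contains [x]. *)
  apply: contrapT => noy.
  have neg (a : G k) : abs (\val (unit_lift p_pr a) - \val x) <= r k ->
      S k.+1 (unit_lift p_pr a) - S k x < 0.
    move=> ax; rewrite subr_lt0 ltNge; apply/negP => h; apply: noy.
    by exists (unit_lift p_pr a).
  have a0 : abs (\val (unit_lift p_pr (unit_proj k x)) - \val x) <= r k.
    by rewrite padic_absB (le_trans (unit_projP k x)) // invXp_le.
  have := Schild k x; rewrite (bigD1 (unit_proj k x)) //= => E.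
  have := neg _ a0; rewrite -[X in X < _]addr0 -[X in _ + X](subrr
    (\sum_(i | (abs (sval (unit_lift p_pr i) - sval x) <= r k) && (i != unit_proj k x))
       (S k.+1 (unit_lift p_pr i) - S k x))) addrA E sub0r oppr_lt0 ltNge => /negP; apply.
  by apply: sumr_le0 => a /andP[/neg/ltW].
have [f fP] : {f : nat -> Zpx p_pr -> Zpx p_pr | forall k x,
    abs (\val (f k x) - \val x) <= r k /\ S k x <= S k.+1 (f k x)}.
  by exists (fun k x => projT1 (cid (step k x))) => k x; exact: projT2 (cid (step k x)).
pose y := fix y i := if i is i'.+1 then f (k0 + i')%N (y i') else x0.
have yS i : S k0 x0 <= S (k0 + i)%N (y i).
  elim: i => [|i IH]; first by rewrite addn0.
  by apply: (le_trans IH); rewrite addnS; exact: (fP _ _).2.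
(* [padic_nested] counts radii from level 0 while the chain of balls starts at level [k0]; truncated
   subtraction repeats [x0] on the missing levels. *)
have [||z zP] := @padic_nested _ p_pr (fun j => \val (y (j - k0)%N)).
- by move=> i; rewrite /Defs.Zp /= Zpx_abs.
- move=> j; case: (leqP k0 j) => jk.
    rewrite subSn //=; have := (fP (k0 + (j - k0))%N (y (j - k0)%N)).1.
    by rewrite subnKC.
  have -> : (j - k0 = 0)%N by apply/eqP; rewrite subn_eq0 ltnW.
  have -> : (j.+1 - k0 = 0)%N by apply/eqP; rewrite subn_eq0.
  by rewrite subrr padic_abs0 ltW // invXp_gt0.
(* A ball about a unit is sure to consist of units only at positive level; hence [k0.+1], since [k0]
   may be 0. *)
have zZ : Zpx p_pr z.
  apply: (Zpx_nearby (set_mem (valP (y (k0.+1 - k0)%N)))).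
  apply: (le_lt_trans (zP k0.+1)); have := invXp_lt p_pr 0 k0.+1.
  by rewrite expr0 invr1 => ->.
pose z' : Zpx p_pr := exist (fun z => z \in Zpx p_pr) z (mem_set zZ).
have Sz i : S k0 x0 <= S (k0 + i)%N z'.
  rewrite (Sinv _ z' (y i)) //; have := zP (k0 + i)%N.
  by rewrite addKn.
have /cvgrPdist_lt /(_ _ c0) [N _ NP] := Slim z'.
have := NP (k0 + N)%N (leq_addl _ _); rewrite sub0r normrN ltNge => /negP; apply.
by rewrite (le_trans (Sz N)) // ler_norm.
Qed.

Lemma ball_martingale_eq0 S : ball_martingale S ->
  (forall x, S k x @[k --> \oo] --> 0) -> forall k x, S k x = 0.
Proof.
move=> Sm Slim k x; apply/eqP; rewrite eq_le (ball_martingale_le0 Sm Slim) /=.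
rewrite -oppr_le0; apply: (@ball_martingale_le0 (fun k x => - S k x)).
- case: Sm => Sinv Schild; split=> [j y z yz|j y]; first by rewrite (Sinv j y z).
  apply: oppr_inj; rewrite oppr0 -[RHS](Schild j y) -sumrN.
  by apply: eq_bigr => a _; rewrite opprB opprK addrC.
- by move=> y; rewrite -oppr0; exact: cvgN.
Qed.

End NestedBalls.

(** * The eigenvalue equation as a vanishing martingale *)

Section RealEigen.
Variables (R : realType) (p : nat) (p_pr : prime p).
Variable mu : {measure set (borelQp p_pr) -> \bar R}.
Hypothesis mu_haar : is_haar mu.
Local Notation abs := (@padic_abs p p_pr).
Local Notation T := (borelQp p_pr).
Local Notation r k := ((p%:R : rat) ^- k).
Local Notation A := (wavg mu).
Local Notation lam := (lambda R p).

(* The hypothesis is the real part of [D0 u = (a + i b) u], with [g] and [h] the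
   real and imaginary parts of [u]. *)
Lemma coupled_eigen (g h : T -> R) (a b : R) :
  mu.-integrable (Zpx p_pr) (EFin \o g) -> mu.-integrable (Zpx p_pr) (EFin \o h) ->
  (forall x, \sum_(n < k) lam n.+1 * (A g n.+1 x - A g n x)
     - (a * A g k x - b * A h k x) @[k --> \oo] --> 0) ->
  (forall x, a * A g 0 x - b * A h 0 x = 0) /\
  (forall k x, lam k.+1 * (A g k.+1 x - A g k x) =
     a * (A g k.+1 x - A g k x) - b * (A h k.+1 x - A h k x)).
Proof.
move=> gi hi lim.
pose M k (x : Zpx p_pr) : R := \sum_(n < k) lam n.+1 * (A g n.+1 x - A g n x).
pose S k (x : Zpx p_pr) : R := M k x - (a * A g k x - b * A h k x).
have Sinv k (x y : Zpx p_pr) : abs (\val x - \val y) <= r k -> S k x = S k y.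
  move=> xy.
  have gk := wavg_eq mu g xy; have hk := wavg_eq mu h xy.
  have E : M k x = M k y.
    apply: eq_bigr => n _.
    have xy1 : abs (\val x - \val y) <= r n.+1 by apply: le_trans xy _; rewrite invXp_le.
    have xy0 : abs (\val x - \val y) <= r n by apply: le_trans xy1 _; rewrite invXp_le.
    by rewrite (wavg_eq mu g xy1) (wavg_eq mu g xy0).
  by rewrite /S gk hk E.
have SS k (x : Zpx p_pr) : S k.+1 x - S k x = (lam k.+1 - a) * (A g k.+1 x - A g k x)
    + b * (A h k.+1 x - A h k x).
  by rewrite /S [M k.+1 x]big_ord_recr /= -/(M k x); ring.
have S0E (x : Zpx p_pr) : S 0%N x = - (a * A g 0 x - b * A h 0 x).
  by rewrite /S [M 0 x]big_ord0 sub0r.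
have Slim (x : Zpx p_pr) : S k x @[k --> \oo] --> 0 := lim x.
clearbody S; clear M lim.
have S0 : forall k x, S k x = 0.
  apply: ball_martingale_eq0; last exact: Slim.
  split; [exact: Sinv|move=> k x].
  (* Since [S k] is constant on the ball of level [k], the parent value can be read at the child,
     where [SS] expresses the increment of [S] through those of the two averages. *)
  transitivity ((lam k.+1 - a) * (\sum_(c : {unit 'Z_(p ^ k.+1)} |
       abs (\val (unit_lift p_pr c) - \val x) <= r k)
       (A g k.+1 (unit_lift p_pr c) - A g k x))
     + b * (\sum_(c : {unit 'Z_(p ^ k.+1)} |
       abs (\val (unit_lift p_pr c) - \val x) <= r k)
       (A h k.+1 (unit_lift p_pr c) - A h k x))); last first.
    by rewrite !wavg_children // !mulr0 addr0.
  rewrite !mulr_sumr -big_split; apply: eq_bigr => c cx.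
  by rewrite -(Sinv _ _ _ cx) SS (wavg_eq mu g cx) (wavg_eq mu h cx).
split=> [x|k x].
  by have := S0E x; rewrite S0 => /esym/eqP; rewrite oppr_eq0 => /eqP.
have := SS k x; rewrite !S0 subr0 => E.
by rewrite [LHS](_ : _ = (lam k.+1 - a) * (A g k.+1 x - A g k x)
    + b * (A h k.+1 x - A h k x) + (a * (A g k.+1 x - A g k x) - b * (A h k.+1 x - A h k x)));
  [rewrite -E add0r|ring].
Qed.

End RealEigen.

(** * Eigenspaces *)

Section Eigenspaces.
Variables (R : realType) (p : nat) (p_pr : prime p).
Variable mu : {measure set (borelQp p_pr) -> \bar R}.
Hypothesis mu_haar : is_haar mu.
Local Notation abs := (@padic_abs p p_pr).
Local Notation T := (borelQp p_pr).
Local Notation r k := ((p%:R : rat) ^- k).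
Local Notation A := (wavg mu).
Local Notation lam := (lambda R p).
Implicit Types (u : Zpx p_pr -> R[i]^o) (x y : Zpx p_pr).

Definition re_ext u (z : T) : R := complex.Re ('valL_0 u z).
Definition im_ext u (z : T) : R := complex.Im ('valL_0 u z).
Definition cavg u k x : R[i] := Complex (A (re_ext u) k x) (A (im_ext u) k x).
Definition ball_inv n u := forall x y, abs (\val x - \val y) <= r n -> u x = u y.

Lemma valL0E u x : 'valL_0 u (\val x) = u x.
Proof. exact: (congr1 (fun f => f x) (valLK 0 u)). Qed.

Lemma re_extE u x : re_ext u (\val x) = complex.Re (u x).
Proof. by rewrite /re_ext valL0E. Qed.

Lemma im_extE u x : im_ext u (\val x) = complex.Im (u x).
Proof. by rewrite /im_ext valL0E. Qed.

Lemma ratr_complex (q : rat) : ratr q = (ratr q : R)%:C%C :> R[i].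
Proof. by rewrite -(fmorph_rat (real_complex R)). Qed.

Lemma Re_D0_integrand u x z :
  complex.Re (D0_integrand u x z) = kern (re_ext u) x z.
Proof.
rewrite /D0_integrand /kern re_extE /re_ext ratr_complex -fmorphV.
by case: ('valL_0 u z) => a b; case: (u x) => c d /=; rewrite mulr0 subr0.
Qed.

Lemma Im_D0_integrand u x z :
  complex.Im (D0_integrand u x z) = kern (im_ext u) x z.
Proof.
rewrite /D0_integrand /kern im_extE /im_ext ratr_complex -fmorphV.
by case: ('valL_0 u z) => a b; case: (u x) => c d /=; rewrite mulr0 add0r.
Qed.

Lemma D0_domainE u : D0_domain mu u <-> forall x,
  mu.-integrable (Zpx p_pr) (EFin \o kern (re_ext u) x) /\
  mu.-integrable (Zpx p_pr) (EFin \o kern (im_ext u) x).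
Proof.
have E x : cintegrable mu (Zpx p_pr) (D0_integrand u x) <->
  mu.-integrable (Zpx p_pr) (EFin \o kern (re_ext u) x) /\
  mu.-integrable (Zpx p_pr) (EFin \o kern (im_ext u) x).
  rewrite /cintegrable.
  rewrite (_ : (fun z => _) = EFin \o kern (re_ext u) x); last first.
    by apply/funext => z; rewrite Re_D0_integrand.
  rewrite (_ : (fun z => (complex.Im _)%:E) = EFin \o kern (im_ext u) x) //.
  by apply/funext => z; rewrite Im_D0_integrand.
by split=> h x; apply/E; exact: h.
Qed.

Lemma D0E u x : D0 mu u x =
  Complex (\int[mu]_(z in Zpx p_pr) kern (re_ext u) x z)
          (\int[mu]_(z in Zpx p_pr) kern (im_ext u) x z).
Proof.
rewrite /D0 /cintegral; congr Complex; apply: eq_Rintegral => z _.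
  exact: Re_D0_integrand.
exact: Im_D0_integrand.
Qed.

Lemma lambda_rmorph (K L : fieldType) (f : {rmorphism K -> L}) n :
  f (lambda K p n) = lambda L p n.
Proof.
case: n => [|n]; rewrite /lambda ?rmorph0 //.
by rewrite rmorphD rmorphB rmorphN fmorph_div !fmorphXz !rmorph_nat.
Qed.

Lemma lambda_complex n : lambda R[i] p n = (lam n)%:C%C.
Proof. by rewrite -(lambda_rmorph (real_complex R)). Qed.

(** The first clause is the case [n = 0] of the vanishing of [(lambda_n - l) E_n u], as
    [lambda_0 = 0] and [E_0 u] is the average over all units. The last clause recovers [u] from its
    averages. *)
Lemma D0_eigenspace_cavg l u : D0_eigenspace mu l u ->
  [/\ forall x, l * cavg u 0 x = 0,
      forall k x, (lambda R[i] p k.+1 - l) * (cavg u k.+1 x - cavg u k x) = 0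
    & forall x, A (re_ext u) k x @[k --> \oo] --> complex.Re (u x) /\
                A (im_ext u) k x @[k --> \oo] --> complex.Im (u x)].
Proof.
case: l => a b [/D0_domainE dom eig].
have cv x : A (re_ext u) k x @[k --> \oo] --> complex.Re (u x) /\
            A (im_ext u) k x @[k --> \oo] --> complex.Im (u x).
  have [ri ii] := dom x; rewrite -re_extE -im_extE.
  by split; apply: wavg_cvg.
(* Integrability of [u] follows from that of its kernel at any one point. *)
have x1 : Zpx p_pr := unit_lift p_pr (1%g : {unit 'Z_(p ^ 1)}).
have gi : mu.-integrable (Zpx p_pr) (EFin \o re_ext u) := kern_integrable mu_haar (dom x1).1.
have hi : mu.-integrable (Zpx p_pr) (EFin \o im_ext u) := kern_integrable mu_haar (dom x1).2.
have eigx x : Complex (\int[mu]_(z in Zpx p_pr) kern (re_ext u) x z)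
          (\int[mu]_(z in Zpx p_pr) kern (im_ext u) x z) = Complex a b * u x.
  by rewrite -D0E eig.
have Ere x : \int[mu]_(z in Zpx p_pr) kern (re_ext u) x z =
    a * complex.Re (u x) - b * complex.Im (u x).
  by have := congr1 (@complex.Re R) (eigx x); case: (u x).
(* The double sign puts the imaginary part in the form of [coupled_eigen], with the two functions
   exchanged and [b] replaced by [- b]. *)
have Eim x : \int[mu]_(z in Zpx p_pr) kern (im_ext u) x z =
    a * complex.Im (u x) - (- b) * complex.Re (u x).
  by have := congr1 (@complex.Im R) (eigx x); case: (u x) => c d /= ->; rewrite mulNr opprK.
have limr x : \sum_(n < k) lam n.+1 * (A (re_ext u) n.+1 x - A (re_ext u) n x)
     - (a * A (re_ext u) k x - b * A (im_ext u) k x) @[k --> \oo] --> 0.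
  have := shell_sum_cvg mu_haar (dom x).1; rewrite Ere => S.
  have H : a * A (re_ext u) k x - b * A (im_ext u) k x @[k --> \oo] -->
      a * complex.Re (u x) - b * complex.Im (u x).
    by apply: cvgB; apply: cvgMr; [exact: (cv x).1|exact: (cv x).2].
  by have := cvgB S H; rewrite subrr; apply.
have limi x : \sum_(n < k) lam n.+1 * (A (im_ext u) n.+1 x - A (im_ext u) n x)
     - (a * A (im_ext u) k x - (- b) * A (re_ext u) k x) @[k --> \oo] --> 0.
  have := shell_sum_cvg mu_haar (dom x).2; rewrite Eim => S.
  have H : a * A (im_ext u) k x - (- b) * A (re_ext u) k x @[k --> \oo] -->
      a * complex.Im (u x) - (- b) * complex.Re (u x).
    by apply: cvgB; apply: cvgMr; [exact: (cv x).2|exact: (cv x).1].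
  by have := cvgB S H; rewrite subrr; apply.
have [r0 rS] := coupled_eigen mu_haar gi hi limr.
have [i0 iS] := coupled_eigen mu_haar hi gi limi.
split=> // [x|k x]; rewrite /cavg ?lambda_complex.
  move: (r0 x) (i0 x); move: (A _ _ _) (A _ _ _) => c d h1 h2.
  apply/eqP; rewrite eq_complex /=; apply/andP; split; apply/eqP => //.
  by rewrite -[RHS]h2; ring.
move: (rS k x) (iS k x).
move: (A (re_ext u) k.+1 x) (A (re_ext u) k x) (A (im_ext u) k.+1 x) (A (im_ext u) k x).
move=> c c' d d' h1 h2; apply/eqP; rewrite eq_complex /=.
by apply/andP; split; apply/eqP; lra.
Qed.

Lemma lambda_decr m n : (m < n)%N -> lam n < lam m.
Proof.
have p0 : 0 < (p%:R : R) by rewrite ltr0n prime_gt0.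
have v0 : 0 < (p%:R^-1 : R) by rewrite invr_gt0.
have p1 : 1 < (p%:R : R) by rewrite ltr1n prime_gt1.
have v1 : p%:R^-1 < (1 : R) by rewrite invf_lt1.
have step k : lam k.+1 < lam k.
  case: k => [|k]; first by rewrite lambdaS // expr0 [X in _ < X]/lambda; lra.
  rewrite !lambdaS // exprS.
  have pk : 0 < (p%:R ^+ k : R) by rewrite exprn_gt0.
  have -> : p%:R * p%:R ^+ k / p%:R = p%:R ^+ k :> R by rewrite mulrAC mulfV ?mul1r // gt_eqF.
  have : p%:R ^+ k / p%:R < p%:R ^+ k * p%:R :> R.
    by rewrite ltr_pM2l // (lt_trans v1).
  lra.
elim: n => // n IH; rewrite ltnS leq_eqVlt => /orP[/eqP->|/IH h]; first exact: step.
exact: lt_trans (step n) h.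
Qed.

Lemma lambda_inj : injective (lambda R[i] p).
Proof.
move=> m n; rewrite !lambda_complex => /(fmorph_inj (real_complex R)) E.
by case: (ltngtP m n) => // /lambda_decr; rewrite E ltxx.
Qed.

Lemma complex_cvg_unique (a b : nat -> R) (z w : R[i]) :
  a @ \oo --> complex.Re z -> b @ \oo --> complex.Im z ->
  (\forall k \near \oo, Complex (a k) (b k) = w) -> z = w.
Proof.
case: z => c d /= ac bd kw.
have [-> ->] : c = complex.Re w /\ d = complex.Im w.
  split; [apply: (cvg_unique _ ac)|apply: (cvg_unique _ bd)] => //;
  apply: cvg_near_cst; near=> k.
    by rewrite -(near kw k).
  by rewrite -(near kw k).
by case: (w).
Unshelve. all: by end_near. Qed.

Lemma cavg_eq u k x y : abs (\val x - \val y) <= r k -> cavg u k x = cavg u k y.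
Proof. by move=> xy; rewrite /cavg !(wavg_eq _ _ xy). Qed.

Lemma D0_eigenspace_other l u : (forall n, l != lambda R[i] p n) ->
  D0_eigenspace mu l u -> u = 0.
Proof.
move=> ln /D0_eigenspace_cavg[l0 lS lim].
have A0 k x : cavg u k x = 0.
  elim: k => [|k IH].
    by have /eqP := l0 x; rewrite mulf_eq0 (negPf (ln 0%N)) => /eqP.
  have /eqP := lS k x; rewrite mulf_eq0 subr_eq0 eq_sym (negPf (ln k.+1)) /= IH subr0.
  by move/eqP.
apply/funext => x; have [h1 h2] := lim x; apply: (complex_cvg_unique h1 h2).
by apply: nearW => k; exact: A0.
Qed.

Lemma D0_eigenspace_lambda n u : D0_eigenspace mu (lambda R[i] p n) u ->
  ball_inv n u /\ (forall m (x : Zpx p_pr), (m < n)%N -> cavg u m x = 0).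
Proof.
move=> /D0_eigenspace_cavg[l0 lS lim].
have step k x : k.+1 != n -> cavg u k.+1 x = cavg u k x.
  move=> kn; have /eqP := lS k x; rewrite mulf_eq0 subr_eq0 (inj_eq lambda_inj) (negPf kn) /=.
  by rewrite subr_eq0 => /eqP.
have lo m x : (m < n)%N -> cavg u m x = 0.
  elim: m => [|m IH] mn.
    have /eqP := l0 x; rewrite mulf_eq0 -[X in _ == X](_ : lambda R[i] p 0 = 0) //.
    by rewrite (inj_eq lambda_inj) gtn_eqF // => /eqP.
  by rewrite step ?IH // ?ltn_eqF // ltnW.
have hi k x : cavg u (n + k) x = cavg u n x.
  elim: k => [|k IH]; first by rewrite addn0.
  by rewrite addnS step ?IH // gtn_eqF // ltnS leq_addr.
have uE x : u x = cavg u n x.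
  have [h1 h2] := lim x; apply: (complex_cvg_unique h1 h2).
  by exists n => // k /= nk; rewrite -[LHS]/(cavg u k x) -(subnKC nk) hi.
by split=> // x y xy; rewrite !uE; exact: cavg_eq.
Qed.

Lemma integrable_ball_inv (F : T -> R) m :
  (forall x y : Zpx p_pr, abs (\val x - \val y) <= r m.+1 -> F (\val x) = F (\val y)) ->
  mu.-integrable (Zpx p_pr) (EFin \o F).
Proof.
move=> Finv; have mZ : measurable (Zpx p_pr : set T) by exact: measurable_Zpx.
have FE x : F (\val x) = F (\val (unit_lift p_pr (unit_proj m x))).
  by apply: Finv; exact: unit_projP.
pose M := \sum_(a : {unit 'Z_(p ^ m.+1)}) `|F (\val (unit_lift p_pr a))|.
apply: (le_integrable mZ _ _ (integrable_cst_Zpx mu_haar M)).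
  apply/measurable_EFinP => _ Y mY.
  have -> : Zpx p_pr `&` F @^-1` Y = (\bigcup_(a in [set a : {unit 'Z_(p ^ m.+1)} | Y (F (\val (unit_lift p_pr a)))])
      wball m.+1 (unit_lift p_pr a) : set T).
    apply/seteqP; split=> [z [zZ Yz]|z [a Ya [zZ za]]].
      pose z' : Zpx p_pr := exist (fun z => z \in Zpx p_pr) z (mem_set zZ).
      exists (unit_proj m z'); first by rewrite /= -FE.
      by split=> //; exact: (unit_projP m z').
    split=> //; pose z' : Zpx p_pr := exist (fun z => z \in Zpx p_pr) z (mem_set zZ).
    by rewrite -[z]/(\val z') /preimage /= (Finv z' (unit_lift p_pr a)).
  by apply: fin_bigcup_measurable => // a _; exact: measurable_wball.
move=> z zZ; rewrite /= lee_fin [leRHS]ger0_norm; last by apply: sumr_ge0.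
pose z' : Zpx p_pr := exist (fun z => z \in Zpx p_pr) z (mem_set zZ).
rewrite -[z]/(\val z') FE /M (bigD1 (unit_proj m z')) //= lerDl; exact: sumr_ge0.
Qed.

Lemma wavg_ball_inv (F : T -> R) n k x : (n <= k)%N ->
  (forall x y : Zpx p_pr, abs (\val x - \val y) <= r n -> F (\val x) = F (\val y)) ->
  A F k x = F (\val x).
Proof.
move=> nk Finv; have -> : A F k x = (\int[mu]_(z in wball k x) F (\val x)) / wvol R p k.
  rewrite /wavg; congr (_ / _); apply: eq_Rintegral => z /set_mem[zZ zx].
  pose z' : Zpx p_pr := exist (fun z => z \in Zpx p_pr) z (mem_set zZ).
  by rewrite -[z]/(\val z'); apply: Finv; apply: le_trans zx _; rewrite invXp_le.
rewrite Rintegral_cst ?mu_wball //; last exact: measurable_wball.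
by rewrite mulfK // lt0r_neq0 // wvol_gt0.
Qed.

(** In the ball of [x] the numerator vanishes, and outside it the distance to [x] is constant on
    balls of level [n]. The singularity is never met, so the kernel takes finitely many values and
    is integrable. *)
Lemma kern_ball_inv (F : T -> R) n x :
  (forall x y : Zpx p_pr, abs (\val x - \val y) <= r n -> F (\val x) = F (\val y)) ->
  forall y z : Zpx p_pr, abs (\val y - \val z) <= r n -> kern F x (\val y) = kern F x (\val z).
Proof.
move=> Finv y z yz; rewrite /kern (Finv y z yz).
case: (lerP (abs (\val z - \val x)) (r n)) => zx.
  by rewrite (Finv z x zx) subrr !mul0r.
rewrite -[\val y - \val x](subrKA (\val z)) (@padic_abs_dominant _ _ (\val y - \val z)) //.
exact: le_lt_trans yz zx.
Qed.

Lemma real_eigen (F : T -> R) n x :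
  (forall x y : Zpx p_pr, abs (\val x - \val y) <= r n -> F (\val x) = F (\val y)) ->
  (forall m (x : Zpx p_pr), (m < n)%N -> A F m x = 0) ->
  mu.-integrable (Zpx p_pr) (EFin \o kern F x) /\
  \int[mu]_(z in Zpx p_pr) kern F x z = lam n * F (\val x).
Proof.
move=> Finv Alo.
have Fi : mu.-integrable (Zpx p_pr) (EFin \o kern F x).
  apply: (@integrable_ball_inv _ n); apply: kern_ball_inv => y z yz.
  by apply: Finv; apply: le_trans yz _; rewrite invXp_le.
split=> //; apply: (cvg_unique _ (shell_sum_cvg mu_haar Fi)) => //.
apply: cvg_near_cst; exists n => // k /= nk.
(* The averages are 0 below level [n] and equal [F x] from level [n] on, so only the jump at [n]
   contributes. For [n = 0] there is no jump, in agreement with [lambda_0 = 0]. *)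
have : \sum_(m < k) lam m.+1 * (A F m.+1 x - A F m x) =
   if (k < n)%N then 0 else lam n * F (\val x).
  elim: k {nk} => [|k IH].
    by rewrite big_ord0; case: posnP => [->|]; rewrite // mul0r.
  rewrite big_ord_recr /= IH; case: (ltngtP k.+1 n) => kn.
  - by rewrite !Alo ?subrr ?mulr0 ?addr0 // ltnW.
  - by rewrite !(wavg_ball_inv x _ Finv) ?subrr ?mulr0 ?addr0 // ltnW.
  - have h0 : A F k x = 0 by apply: Alo; rewrite -kn.
    have h1 : A F k.+1 x = F (\val x) by apply: (wavg_ball_inv x _ Finv); rewrite kn.
    by rewrite h0 h1 subr0 add0r kn.
by rewrite ltnNge nk.
Qed.

Lemma ball_inv_eigenspace n u : ball_inv n u ->
  (forall m (x : Zpx p_pr), (m < n)%N -> cavg u m x = 0) -> D0_eigenspace mu (lambda R[i] p n) u.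
Proof.
move=> uinv ulo.
have rinv x y : abs (\val x - \val y) <= r n -> re_ext u (\val x) = re_ext u (\val y).
  by move=> xy; rewrite !re_extE (uinv x y xy).
have iinv x y : abs (\val x - \val y) <= r n -> im_ext u (\val x) = im_ext u (\val y).
  by move=> xy; rewrite !im_extE (uinv x y xy).
have rlo m x : (m < n)%N -> A (re_ext u) m x = 0.
  by move=> mn; have := congr1 (@complex.Re R) (ulo m x mn).
have ilo m x : (m < n)%N -> A (im_ext u) m x = 0.
  by move=> mn; have := congr1 (@complex.Im R) (ulo m x mn).
split.
  apply/D0_domainE => x; split; first exact: (real_eigen x rinv rlo).1.
  exact: (real_eigen x iinv ilo).1.
apply/funext => x; rewrite D0E (real_eigen x rinv rlo).2 (real_eigen x iinv ilo).2.
rewrite re_extE im_extE lambda_complex -[RHS]/((lam n)%:C%C * u x).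
by case: (u x) => a b; apply/eqP; rewrite eq_complex /= !mul0r subr0 addr0 !eqxx.
Qed.

End Eigenspaces.

(** * Characters of a finite abelian group *)

Section FiniteCharacters.
Variables (C : numClosedFieldType) (gT : finGroupType).
Hypothesis mulgC_ab : forall a b : gT, (a * b = b * a)%g.

(** The regular representation acting on row vectors: a function [f] on the group, read as a row, is
    sent to [h |-> f (g * h)]. *)
Definition translation_mx (g : gT) : 'M[C]_#|gT| :=
  \matrix_(i, j) (i == enum_rank (g * enum_val j)%g)%:R.

Lemma mul_translation_mx m (A : 'M[C]_(m, #|gT|)) g i j :
  (A *m translation_mx g) i j = A i (enum_rank (g * enum_val j)%g).
Proof.
rewrite mxE (bigD1 (enum_rank (g * enum_val j)%g)) //= mxE eqxx mulr1 big1 ?addr0 //.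
by move=> k kj; rewrite mxE (negPf kj) mulr0.
Qed.

Lemma translation_mxM g h :
  translation_mx g *m translation_mx h = translation_mx (g * h)%g.
Proof.
apply/matrixP => i j; rewrite mul_translation_mx !mxE enum_rankK.
by rewrite mulgA.
Qed.

Lemma translation_mx1 : translation_mx 1%g = 1%:M.
Proof. by apply/matrixP => i j; rewrite !mxE mul1g enum_valK. Qed.

(* [e] stands for the powers of [A]: matrices of size [n] have a ring structure
   only when [n] is a successor. *)
Lemma diagonalizable_finite_order n (A : 'M[C]_n) N : (0 < N)%N ->
  (forall (e : nat -> 'M[C]_n), e 0%N = 1%:M -> (forall k, e k.+1 = A *m e k) -> e N = 1%:M) ->
  exists2 P : 'M[C]_n, P \in unitmx & mxred.similar_to P A is_diag_mx.
Proof.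
case: n A => [|n] A N0 AN.
  by exists 1%:M; rewrite ?unitmx1 //; apply/is_diag_mxP => -[].
apply/mxred.diagonalizableP.
(* [A] is annihilated by [X^N - 1], which splits with simple roots over [C]; its minimal polynomial
   divides it. *)
have [rs rsE] := closed_field_poly_normal ('X^N - 1 : {poly C}).
have lc : lead_coef ('X^N - 1 : {poly C}) = 1 by apply/monicP; exact: monicXnsubC.
rewrite lc scale1r in rsE; exists rs.
  by rewrite -separable_prod_XsubC -rsE separable_Xn_sub_1 // pnatr_eq0 -lt0n.
rewrite -rsE; apply: mxminpoly_min; rewrite rmorphB rmorphXn /= horner_mx_X rmorph1.
by apply/eqP; rewrite subr_eq0; apply/eqP; apply: (AN (fun k => A ^+ k)) => // k; rewrite exprS.
Qed.

(** The translations commute and have finite order, so one invertible [P] diagonalizes them all.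
    Each row of [P] is a common eigenvector, and its eigenvalue as a function of [g] is a character.
    All the characters come at once, and the group may fail to be cyclic, as the units modulo a
    power of 2 do. *)
Lemma finite_characters : exists psi : 'I_#|gT| -> gT -> C,
  [/\ forall i a b, psi i (a * b)%g = psi i a * psi i b,
      forall i, psi i 1%g = 1,
      forall i j, psi i =1 psi j -> i = j
    & forall f : gT -> C, exists c : 'I_#|gT| -> C,
        forall a, f a = \sum_i c i * psi i a].
Proof.
have [P Pu /allP PD] : exists2 P : 'M[C]_#|gT|, P \in unitmx &
    all [pred A | mxred.similar_to P A is_diag_mx] [seq translation_mx g | g <- enum gT].
  apply/mxred.codiagonalizableP; split.
    move=> _ _ /mapP[g _ ->] /mapP[h _ ->].
    by rewrite /comm_mx !translation_mxM mulgC_ab.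
  move=> _ /mapP[g _ ->]; apply: (@diagonalizable_finite_order _ _ #[g]%g).
    exact: order_gt0.
  move=> e e0 eS; have -> : e #[g]%g = translation_mx (g ^+ #[g])%g.
    elim: #[g]%g => [|k IH]; first by rewrite e0 expg0 translation_mx1.
    by rewrite eS IH translation_mxM expgS.
  by rewrite expg_order translation_mx1.
have TD g : exists d : 'rV[C]_#|gT|, P *m translation_mx g = diag_mx d *m P.
  have /PD /mxred.similar_diagPex[d /(mxred.similarP Pu) E] :
      translation_mx g \in [seq translation_mx g | g <- enum gT].
    by apply: map_f; rewrite mem_enum.
  by exists d.
have {}TD g : {d : 'rV[C]_#|gT| | P *m translation_mx g = diag_mx d *m P}.
  exact: cid (TD g).
pose psi i g := projT1 (TD g) 0 i.
have psiE i g h : P i (enum_rank (g * h)%g) = psi i g * P i (enum_rank h).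
  have /matrixP/(_ i (enum_rank h)) := projT2 (TD g).
  by rewrite mul_translation_mx enum_rankK => ->; rewrite mul_diag_mx mxE.
have row0 (v : 'rV[C]_#|gT|) : v *m P = 0 -> v = 0.
  by move=> vP; rewrite -[v](mulmxK Pu) vP mul0mx.
(* By [psiE] the entry at 1 determines the row, and a row of an invertible matrix is not 0. So each
   row is a nonzero multiple of its character. *)
have P0 i : P i (enum_rank 1%g) != 0.
  apply/negP => /eqP P0; have : delta_mx 0 i = 0 :> 'rV[C]_#|gT|.
    apply: row0; rewrite -rowE; apply/rowP => j; rewrite !mxE.
    by rewrite -[j]enum_valK -[enum_val j]mulg1 psiE P0 mulr0.
  by move=> /rowP/(_ i) /eqP; rewrite !mxE !eqxx oner_eq0.
have psiP i g : P i (enum_rank g) = psi i g * P i (enum_rank 1%g).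
  by rewrite -psiE mulg1.
exists psi; split=> [i a b|i|i j ij|f].
- apply: (mulIf (P0 i)); rewrite -psiP psiE (psiP i b) mulrA //.
- by apply: (mulIf (P0 i)); rewrite -psiP mul1r.
(* Two rows with the same character would be proportional; the row vector built here witnesses the
   relation. *)
- apply/eqP; apply: contraT => ne.
  have : P j (enum_rank 1%g) *: delta_mx 0 i - P i (enum_rank 1%g) *: delta_mx 0 j
      = 0 :> 'rV[C]_#|gT|.
    apply: row0; rewrite mulmxBl -!scalemxAl -!rowE; apply/rowP => k; rewrite !mxE.
    rewrite -[k]enum_valK (psiP i (enum_val k)) (psiP j (enum_val k)) ij.
    by rewrite mulrCA (mulrCA (P i _)) (mulrC (P j _)) subrr.
  move=> /rowP/(_ i) /eqP; rewrite !mxE !eqxx (negPf ne) mulr1 mulr0 subr0.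
  by rewrite (negPf (P0 j)).
(* Coordinates of [f] in the rows of [P], rescaled by the values at 1 to pass from rows to
   characters. *)
- pose w := (\row_j f (enum_val j)) *m invmx P.
  exists (fun i => w 0 i * P i (enum_rank 1%g)) => a.
  have /rowP/(_ (enum_rank a)) : w *m P = \row_j f (enum_val j) by rewrite mulmxKV.
  rewrite !mxE enum_rankK => <-; apply: eq_bigr => i _.
  by rewrite psiP; ring.
Qed.

Definition group_character (f : gT -> C) :=
  (forall a b, f (a * b)%g = f a * f b) /\ f 1%g = 1.

Lemma group_character_neq0 f a : group_character f -> f a != 0.
Proof.
move=> [fM f1]; apply: contraTneq (oner_neq0 C) => fa.
by rewrite -f1 -(mulgV a) fM fa mul0r eqxx.
Qed.

(** Translation by [b] multiplies the sum by [f b / g b], which is not 1. The inverse of [g a]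
    stands for its conjugate: values of characters of a finite group are roots of unity. *)
Lemma group_character_orthogonal f g : group_character f -> group_character g ->
  (exists b, f b != g b) -> \sum_a f a / g a = 0.
Proof.
move=> fc gc [b fgb]; have gb := group_character_neq0 b gc.
have : (f b / g b) * (\sum_a f a / g a) = \sum_a f a / g a.
  rewrite [RHS](reindex_inj (mulgI b)) /= mulr_sumr; apply: eq_bigr => a _.
  by rewrite fc.1 gc.1 invfM mulrACA.
move/eqP; rewrite -subr_eq0 -[X in _ - X]mul1r -mulrBl mulf_eq0 => /orP[|/eqP//].
rewrite subr_eq0 => /eqP E; case/eqP: fgb.
by rewrite -[f b](mulfVK gb) E mul1r.
Qed.

Lemma group_character_norm f : group_character f -> \sum_a f a / f a = #|gT|%:R.
Proof.
move=> fc; rewrite (eq_bigr (fun=> 1)) => [|a _]; first by rewrite sumr_const.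
by rewrite divff // group_character_neq0.
Qed.

(** Otherwise [f] would be orthogonal to every term of its own expansion, against
    [group_character_norm]. This makes a spanning family of characters exhaustive. *)
Lemma group_character_in_span f (I : finType) (psi : I -> gT -> C) (c : I -> C) :
  group_character f -> (forall i, group_character (psi i)) ->
  (forall a, f a = \sum_i c i * psi i a) -> exists i, f =1 psi i.
Proof.
move=> fc pc fE; apply: contrapT => nof.
have : \sum_a f a / f a = \sum_i c i * (\sum_a psi i a / f a).
  transitivity (\sum_a \sum_i c i * (psi i a / f a)).
    by apply: eq_bigr => a _; rewrite {1}fE mulr_suml; apply: eq_bigr => i _; rewrite mulrA.
  by rewrite exchange_big; apply: eq_bigr => i _; rewrite mulr_sumr.
rewrite group_character_norm // big1 => [|i _].
  by move/eqP; rewrite pnatr_eq0 => /eqP/card0_eq/(_ 1%g); rewrite inE.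
rewrite group_character_orthogonal ?mulr0 //.
apply: contrapT => h; apply: nof; exists i => a; apply/eqP; apply: contraT => ne.
by case: h; exists a; rewrite eq_sym.
Qed.

End FiniteCharacters.

(** * Characters of [Z_p^*] *)

Section Conductors.
Variables (R : realType) (p : nat) (p_pr : prime p).
Local Notation abs := (@padic_abs p p_pr).
Local Notation r k := ((p%:R : rat) ^- k).
Local Notation G m := {unit 'Z_(p ^ m.+1)}.
Local Notation lift := (unit_lift p_pr).
Implicit Types (chi : Zpx p_pr -> R[i]^o) (x y : Zpx p_pr).

Lemma padic_abs_Xp n : abs (p%:R ^+ n) = r n.
Proof.
rewrite -natrX; apply: padic_abs_lt; rewrite padic_abs_nat_le ?dvdnn //.
by rewrite dvdn_Pexp2l ?prime_gt1 // ltnn.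
Qed.

Lemma one_plus_pnZpE n (z : Qp p_pr) : @one_plus_pnZp p p_pr n z <-> abs (z - 1) <= r n.
Proof.
have p0 : (p%:R ^+ n : Qp p_pr) != 0.
  by rewrite -padic_abs_eq0 padic_abs_Xp gt_eqF // invXp_gt0.
split=> [[y y1 <-]|zn].
  by rewrite addrAC subrr add0r padic_absM padic_abs_Xp ler_piMr // ltW // invXp_gt0.
exists ((z - 1) / p%:R ^+ n); last by rewrite mulrC divfK // addrC subrK.
have := padic_absM (p%:R ^+ n) ((z - 1) / p%:R ^+ n); rewrite mulrC divfK // padic_abs_Xp => E.
by rewrite /Defs.Zp /= -(ler_pM2l (invXp_gt0 p_pr n)) mulr1 -E.
Qed.

Definition multiplicative chi := forall x y, chi (Zpx_mul x y) = chi x * chi y.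

Lemma val_unit_lift1 m : \val (lift (1%g : G m)) = 1.
Proof.
have <- : (1%N%:R : Qp p_pr) = 1 by [].
change ((\val (\val (1%g : G m)))%:R = 1%N%:R :> Qp p_pr); congr (_%:R).
Qed.

Lemma Zpx_quotient x y : exists w : Zpx p_pr, x = Zpx_mul y w /\
  \val w - 1 = (\val x - \val y) / \val y.
Proof.
have y0 : \val y != 0 by rewrite -padic_abs_eq0 Zpx_abs oner_neq0.
have wZ : Zpx p_pr (\val x / \val y).
  apply/ZpxP; have := padic_absM (\val y) (\val x / \val y).
  by rewrite mulrC divfK // !Zpx_abs mul1r.
exists (exist (fun z => z \in Zpx p_pr) _ (mem_set wZ)); split.
  by apply: val_inj; rewrite /= mulrC divfK.
by rewrite mulrBl mulfV.
Qed.

Lemma trivial_on_ball_inv chi n : multiplicative chi ->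
  trivial_on chi (@one_plus_pnZp p p_pr n) -> ball_inv n chi.
Proof.
move=> chiM chi1 x y xy; have [w [xE wE]] := Zpx_quotient x y.
have y0 : \val y != 0 by rewrite -padic_abs_eq0 Zpx_abs oner_neq0.
have w1 : chi w = 1.
  apply: chi1; apply/one_plus_pnZpE; rewrite wE.
  have := padic_absM (\val y) ((\val x - \val y) / \val y).
  by rewrite mulrC divfK // Zpx_abs mul1r => <-.
by rewrite xE chiM w1 mulr1.
Qed.

Lemma ball_inv_trivial_on chi n : chi (lift (1%g : G 0)) = 1 ->
  ball_inv n chi -> trivial_on chi (@one_plus_pnZp p p_pr n).
Proof.
move=> chi1 chin x /one_plus_pnZpE x1; rewrite -chi1; apply: chin.
by rewrite val_unit_lift1.
Qed.

Definition level_characters n : set (Zpx p_pr -> R[i]^o) :=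
  [set chi | is_character chi /\ trivial_on chi (@one_plus_pnZp p p_pr n)].

Lemma level_charactersS n m : (n <= m)%N -> level_characters n `<=` level_characters m.
Proof.
move=> nm chi [chic chi1]; split=> // x /one_plus_pnZpE x1; apply: chi1.
by apply/one_plus_pnZpE; apply: le_trans x1 _; rewrite invXp_le.
Qed.

Lemma is_character1 : is_character (cst 1 : Zpx p_pr -> R[i]^o).
Proof.
split=> [|x|x y]; [exact: cst_continuous|exact: normr1|by rewrite mulr1].
Qed.

Lemma level_characters0 : level_characters 0 = [set (fun=> 1)].
Proof.
apply/seteqP; split=> [chi [_ chi1]|_ ->]; last by split=> //; exact: is_character1.
apply/funext => x; apply: chi1; apply/one_plus_pnZpE.
rewrite expr0 invr1 (le_trans (padic_abs_ultra _ _)) // padic_absN padic_abs1.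
by rewrite Zpx_abs maxxx.
Qed.

(** Level 0 is included on purpose: every unit lies in [1 + Zp], so [level_characters 0] is the
    trivial character alone, and removing it is the nontriviality clause of conductor 1. *)
Lemma conductorS n :
  [set chi | is_character chi /\ has_conductor chi n.+1] =
  level_characters n.+1 `\` level_characters n.
Proof.
apply/seteqP; split=> [chi [chic [chiN1 _ chin chimin]]|chi [[chic chin] chiNn]].
  split=> // -[_ chin']; case: n chin chimin chin' => [|n] chin chimin chin'.
    have : level_characters 0 chi by [].
    by rewrite level_characters0 => E; rewrite E eqxx in chiN1.
  by have := chimin n.+1 isT chin'; rewrite ltnn.
split=> //; split=> //.
  by apply/eqP => E; apply: chiNn; split=> // x _; rewrite E.
move=> m m0 chim; rewrite ltnNge; apply/negP => mn; apply: chiNn.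
by apply: (level_charactersS mn).
Qed.

Lemma continuous_ball_inv chi n : ball_inv n chi -> continuous chi.
Proof.
move=> chin x.
have xb : nbhs (\val x) (pball n (\val x) : set (Qp p_pr)).
  apply: open_nbhs_nbhs; split; first exact: open_pball.
  by rewrite /pball /= subrr padic_abs0 ltW // invXp_gt0.
have xN := @initial_continuous _ _ (set_val : Zpx p_pr -> Qp p_pr) x _ xb.
apply: (@cvg_near_cst _ _ _ _ (nbhs x) (nbhs_filter x)).
by apply: (@filterS _ (nbhs x) (nbhs_filter x) _ _ _ xN) => y yx; exact: chin.
Qed.

Definition pull m (f : G m -> R[i]) : Zpx p_pr -> R[i]^o := fun x => f (unit_proj m x).

Lemma pull_ball_inv m (f : G m -> R[i]) : ball_inv m.+1 (pull f).
Proof. by move=> x y /unit_proj_eq xy; rewrite /pull xy. Qed.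

Lemma pull_lift m chi : ball_inv m.+1 chi -> chi = pull (fun a : G m => chi (lift a)).
Proof. by move=> chim; apply/funext => x; apply: chim; exact: unit_projP. Qed.

Lemma pull_level_characters m (f : G m -> R[i]) : group_character f ->
  level_characters m.+1 (pull f).
Proof.
move=> fc; split; last first.
  apply: ball_inv_trivial_on (pull_ball_inv f).
  rewrite /pull (_ : unit_proj m _ = 1%g) ?fc.2 //.
  rewrite -[RHS](unit_liftK p_pr); apply/unit_proj_eq.
  by rewrite !val_unit_lift1 subrr padic_abs0 ltW // invXp_gt0.
split=> [|x|x y].
- exact: continuous_ball_inv (pull_ball_inv f).
- rewrite /pull; set a := unit_proj m x.
  have fX k : f (a ^+ k)%g = f a ^+ k.
    by elim: k => [|k IH]; rewrite ?expg0 ?fc.2 // expgS exprS fc.1 IH.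
  have := fX #[a]%g; rewrite expg_order fc.2 => /(congr1 Num.norm).
  rewrite normr1 normrX => /esym/eqP.
  by rewrite pexpr_eq1 ?order_gt0 // => /eqP.
- by rewrite /pull unit_projM fc.1.
Qed.

Lemma level_character_lift m chi : level_characters m.+1 chi ->
  group_character (fun a : G m => chi (lift a) : R[i]).
Proof.
move=> [[chic chi1 chiM] chit]; have inv := trivial_on_ball_inv chiM chit; split=> [a b|].
  rewrite -chiM; apply: inv; apply/unit_proj_eq.
  by rewrite unit_projM !unit_liftK.
by apply: chit; apply/one_plus_pnZpE; rewrite val_unit_lift1 subrr padic_abs0 ltW // invXp_gt0.
Qed.

Lemma level_characters_lin_indep m (B : set (Zpx p_pr -> R[i]^o)) :
  B `<=` level_characters m.+1 -> lin_indep B.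
Proof.
move=> BX k e c einj eB E j.
have ec i := level_character_lift (BX _ (eB i)).
have inv i : ball_inv m.+1 (e i).
  by have [[_ _ eM] et] := BX _ (eB i); exact: trivial_on_ball_inv.
have : \sum_i c i * (\sum_(a : G m) e i (lift a) / e j (lift a)) = 0.
  transitivity (\sum_(a : G m) (\sum_i c i *: e i) (lift a) / e j (lift a)); last first.
    by rewrite E big1 // => a _; rewrite mul0r.
  rewrite [RHS](eq_bigr (fun a => \sum_i c i * (e i (lift a) / e j (lift a)))); last first.
    move=> a _; rewrite fct_sumE mulr_suml; apply: eq_bigr => i _.
    by rewrite mulrA.
  by rewrite exchange_big; apply: eq_bigr => i _; rewrite mulr_sumr.
rewrite (bigD1 j) //= (group_character_norm (ec j)) big1 ?addr0 => [|i ij].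
  move/eqP; rewrite mulf_eq0 => /orP[/eqP//|].
  by rewrite pnatr_eq0 => /eqP/card0_eq/(_ 1%g); rewrite inE.
rewrite (group_character_orthogonal (ec i) (ec j)) ?mulr0 //.
apply: contrapT => h; case/eqP: ij; apply: einj.
rewrite (pull_lift (inv i)) (pull_lift (inv j)); apply/funext => x; rewrite /pull.
by apply/eqP; apply: contraT => ne; case: h; eexists; exact: ne.
Qed.

Lemma unit_mulgC m (a b : G m) : (a * b = b * a)%g.
Proof. by apply: val_inj; rewrite /= mulrC. Qed.

(** A single family, indexed by the order of the units modulo [p^(m+1)], serves both to count the
    characters and to expand the invariant functions. *)
Lemma level_characters_basis m : exists psi : 'I_(p.-1 * p ^ m) -> Zpx p_pr -> R[i]^o,
  [/\ injective psi, range psi = level_characters m.+1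
    & forall u, ball_inv m.+1 u -> exists c : 'I_(p.-1 * p ^ m) -> R[i],
        u = \sum_i c i *: psi i].
Proof.
have [psi [psiM psi1 psiI psiS]] := @finite_characters (R[i] : numClosedFieldType) _ (@unit_mulgC m).
(* The type of [psi] depends on the cardinal, which must be rewritten in all its properties at
   once. *)
move: psi psiM psi1 psiI psiS; rewrite (card_unit_quotient p_pr) => psi psiM psi1 psiI psiS.
have psic i : group_character (psi i) by split; [exact: psiM|exact: psi1].
exists (fun i => pull (psi i)); split=> [i j ij|| u uinv].
- apply: psiI => a; have := congr1 (fun f => f (lift a)) ij.
  by rewrite /pull unit_liftK.
- apply/seteqP; split=> [_ [i _ <-]|chi chiX]; first exact: pull_level_characters.
  have [c cE] := psiS (fun a => chi (lift a)).
  have [i iE] := group_character_in_span (level_character_lift chiX) psic cE.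
  have [[_ _ chiM] chit] := chiX.
  exists i => //; rewrite [RHS](pull_lift (trivial_on_ball_inv chiM chit)).
  by apply/funext => x; rewrite /pull iE.
- have [c cE] := psiS (fun a => u (lift a)); exists c.
  rewrite {1}(pull_lift uinv); apply/funext => x; rewrite /pull cE fct_sumE.
  exact: eq_bigr.
Qed.

End Conductors.

(** * Bases and dimensions *)

Section LinearAlgebra.
Variables (K : fieldType) (V : lmodType K).

Lemma lin_span_sum (B : set V) (I : finType) (P : pred I) (e : I -> V) (c : I -> K) :
  (forall i, P i -> B (e i)) -> lin_span B (\sum_(i | P i) c i *: e i).
Proof.
move=> eB; exists #|P|, (fun j => e (enum_val j)), (fun j => c (enum_val j)); split.
  by move=> j; apply: eB; exact: (enum_valP j).
exact: (big_enum_val (A := P) (fun i => c i *: e i)).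
Qed.

Lemma has_dim_eq0 (E : set V) : has_dim E 0 -> forall v, E v -> v = 0.
Proof.
move=> [B B0 [_ <-]] v [k [e [c [eB ->]]]].
rewrite big1 // => i _; exfalso; have := eB i.
by move: B0; rewrite II0 card_eq0 => /eqP ->.
Qed.

Lemma has_dim_neq0 (E : set V) n : (0 < n)%N -> has_dim E n -> exists2 v, E v & v != 0.
Proof.
case: n => // n _ [B Bn [indep <-]].
have /set0P[b Bb] : B != set0.
  apply/negP => /eqP B0; move: Bn; rewrite B0 card_eq_sym card_eq0 => /eqP I0.
  by have : `I_n.+1 0%N by []; rewrite I0.
exists b.
  by exists 1%N, (fun=> b), (fun=> 1); split=> //; rewrite big_ord1 scale1r.
apply/eqP => b0; have inj : injective (fun _ : 'I_1 => b) by move=> i j _; rewrite !ord1.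
have := indep 1%N (fun=> b) (fun=> 1) inj (fun=> Bb) _ ord0.
rewrite big_ord1 b0 scaler0 => /(_ erefl)/eqP; by rewrite oner_eq0.
Qed.

Lemma card_range d (f : 'I_d -> V) : injective f -> (range f #= `I_d)%card.
Proof.
move=> finj; apply: card_eq_trans (inj_card_eq _) _; first by move=> i j _ _; exact: finj.
by rewrite card_eq_sym; exact: card_II.
Qed.

Lemma card_range_subset d (f : 'I_d -> V) (P : pred 'I_d) : injective f ->
  (f @` [set i | P i] #= `I_#|P|)%card.
Proof.
move=> finj; have -> : f @` [set i | P i] = range (fun j : 'I_#|P| => f (enum_val j)).
  apply/seteqP; split=> [_ [i Pi <-]|_ [j _ <-]].
    by exists (enum_rank_in (A := P) Pi i) => //; rewrite enum_rankK_in.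
  by exists (enum_val j) => //; exact: (enum_valP j).
by apply: card_range => i j /finj; exact: enum_val_inj.
Qed.

Lemma card_singleton (v : V) : ([set v] #= `I_1)%card.
Proof.
have <- : range (fun _ : 'I_1 => v) = [set v].
  by apply/seteqP; split=> [_ [i _ <-]//|_ ->]; exists ord0.
by apply: card_range => i j _; rewrite !ord1.
Qed.

End LinearAlgebra.

(** * Averages of characters, bases and dimensions of the eigenspaces *)

Section FiniteAverages.
Variables (R : realType) (p : nat) (p_pr : prime p).
Variable mu : {measure set (borelQp p_pr) -> \bar R}.
Hypothesis mu_haar : is_haar mu.
Local Notation abs := (@padic_abs p p_pr).
Local Notation r k := ((p%:R : rat) ^- k).
Local Notation G m := {unit 'Z_(p ^ m.+1)}.
Local Notation lift := (unit_lift p_pr).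
Local Notation X := (@level_characters R p p_pr).
Implicit Types (u chi : Zpx p_pr -> R[i]^o) (x y : Zpx p_pr).

Lemma wavg_sum (F : borelQp p_pr -> R) m k x : (k <= m.+1)%N ->
  (forall x y, abs (\val x - \val y) <= r m.+1 -> F (\val x) = F (\val y)) ->
  wavg mu F k x = (\sum_(a : G m | abs (\val (lift a) - \val x) <= r k) F (\val (lift a)))
    * (wvol R p m.+1 / wvol R p k).
Proof.
move=> km Finv; rewrite /wavg (Rintegral_wball_split _ km (integrable_ball_inv mu_haar Finv)).
rewrite mulrA [in RHS]mulr_suml (eq_bigr (fun a => F (\val (lift a)) * wvol R p m.+1)) // => a _.
rewrite -(wavg_ball_inv mu_haar (lift a) (leqnn m.+1) Finv) /wavg.
by rewrite divfK // lt0r_neq0 // wvol_gt0.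
Qed.

Lemma Complex_sum (I : finType) (P : pred I) (z : I -> R[i]) :
  Complex (\sum_(i | P i) complex.Re (z i)) (\sum_(i | P i) complex.Im (z i)) =
  \sum_(i | P i) z i.
Proof.
apply/eqP; rewrite eq_complex /=.
rewrite (big_morph (@complex.Re R) (id1 := 0) (op1 := +%R)) //; last by case=> ? ? [].
rewrite (big_morph (@complex.Im R) (id1 := 0) (op1 := +%R)) //; last by case=> ? ? [].
by rewrite !eqxx.
Qed.

Lemma cavg_sum u m k x : (k <= m.+1)%N -> ball_inv m.+1 u ->
  cavg mu u k x = (\sum_(a : G m | abs (\val (lift a) - \val x) <= r k) u (lift a))
    * (wvol R p m.+1 / wvol R p k)%:C%C.
Proof.
move=> km uinv; rewrite -Complex_sum /cavg.
rewrite (wavg_sum x km); last by move=> y z yz; rewrite !re_extE (uinv y z yz).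
rewrite (wavg_sum x km); last by move=> y z yz; rewrite !im_extE (uinv y z yz).
rewrite (eq_bigr _ (fun a _ => re_extE u (lift a))) (eq_bigr _ (fun a _ => im_extE u (lift a))).
by apply/eqP; rewrite eq_complex /= !mulr0 subr0 add0r !eqxx.
Qed.

(** On invariant functions the averages are finite sums, so complex linearity follows with no
    splitting of the scalars into real and imaginary parts. *)
Lemma cavg_lin m k x (I : finType) (c : I -> R[i]) (e : I -> Zpx p_pr -> R[i]^o) :
  (k <= m.+1)%N -> (forall i, ball_inv m.+1 (e i)) ->
  cavg mu (\sum_i c i *: e i) k x = \sum_i c i * cavg mu (e i) k x.
Proof.
move=> km einv.
have sinv : ball_inv m.+1 (\sum_i c i *: e i).
  move=> y z yz; rewrite !fct_sumE; apply: eq_bigr => i _.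
  by rewrite -[LHS]/(c i * e i y) (einv i y z yz).
rewrite (cavg_sum x km sinv) (eq_bigr (fun i => c i *
   (\sum_(a : G m | abs (\val (lift a) - \val x) <= r k) e i (lift a)) *
    (wvol R p m.+1 / wvol R p k)%:C%C)) => [|i _]; last first.
  by rewrite (cavg_sum x km (einv i)) mulrA.
rewrite -mulr_suml; congr (_ * _).
rewrite (eq_bigr (fun a => \sum_i c i * e i (lift a))) => [|a _]; last by rewrite fct_sumE.
by rewrite exchange_big; apply: eq_bigr => i _; rewrite mulr_sumr.
Qed.

Lemma cavg_ball_inv u n k x : (n <= k)%N -> ball_inv n u -> cavg mu u k x = u x.
Proof.
move=> nk uinv; rewrite /cavg (wavg_ball_inv mu_haar x nk); last first.
  by move=> y z yz; rewrite !re_extE (uinv y z yz).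
rewrite (wavg_ball_inv mu_haar x nk); last first.
  by move=> y z yz; rewrite !im_extE (uinv y z yz).
by rewrite re_extE im_extE; case: (u x).
Qed.

(** Some [h] in [1 + p^k Zp] has [chi h != 1]. Multiplication by [h] permutes the classes inside the
    ball and multiplies the sum over them by [chi h]. *)
Lemma cavg_character chi m k x : (k <= m.+1)%N -> X m.+1 chi -> ~ X k chi ->
  cavg mu chi k x = 0.
Proof.
move=> km chiX chiN; have [chic chit] := chiX; have [_ _ chiM] := chic.
have inv := trivial_on_ball_inv chiM chit.
have [h hk h1] : exists2 h : Zpx p_pr, abs (\val h - 1) <= r k & chi h != 1.
  apply: contrapT => noh; apply: chiN; split=> // h /one_plus_pnZpE hk.
  by apply/eqP; apply: contraT => h1; case: noh; exists h.
have close (a : G m) : abs (\val (lift (a * unit_proj m h)%g) - \val (lift a)) <= r k.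
  have e1 : abs (\val (lift (a * unit_proj m h)%g) - \val (Zpx_mul (lift a) h)) <= r k.
    apply: le_trans (_ : r m.+1 <= _); last by rewrite invXp_le.
    by apply/unit_proj_eq; rewrite unit_projM !unit_liftK.
  apply: (padic_le_trans e1).
  have E : \val (Zpx_mul (lift a) h) - \val (lift a) = \val (lift a) * (\val h - 1).
    by rewrite mulrBr mulr1.
  by rewrite E padic_absM Zpx_abs mul1r.
rewrite (cavg_sum x km inv); set S := \sum_(a | _) _.
have : chi h * S = S.
  rewrite [RHS](reindex_inj (mulIg (unit_proj m h))) /= mulr_sumr.
  apply: eq_big => [a|a _].
    apply/idP/idP => ax; first exact: padic_le_trans (close a) ax.
    by apply: padic_le_trans ax; rewrite padic_absB close.
  rewrite mulrC -chiM; apply: inv; apply/unit_proj_eq.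
  by rewrite unit_projM !unit_liftK.
move/eqP; rewrite -subr_eq0 -[X in _ - X]mul1r -mulrBl mulf_eq0 subr_eq0 (negPf h1) /=.
by move/eqP => ->; rewrite mul0r.
Qed.

Local Notation E n := (D0_eigenspace mu (lambda R[i] p n)).

Lemma conductor_basis m : is_basis (X m.+1 `\` X m) (E m.+1).
Proof.
split; first by apply: (@level_characters_lin_indep _ _ _ m) => chi [].
apply/seteqP; split=> [_ [k [e [c [eB ->]]]]|u /(D0_eigenspace_lambda mu_haar)[uinv ulo]].
  have einv i : ball_inv m.+1 (e i).
    by have [[[_ _ eM] et] _] := eB i; exact: trivial_on_ball_inv.
  apply: (ball_inv_eigenspace mu_haar) => [x y xy|k' x k'm].
    rewrite !fct_sumE; apply: eq_bigr => i _.
    by rewrite -[LHS]/(c i * e i x) (einv i x y xy).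
  rewrite (cavg_lin x c (ltnW k'm) einv) big1 // => i _.
  have [eX eN] := eB i; rewrite (@cavg_character _ m) ?mulr0 // 1?ltnW // => eX'.
  by apply: eN; apply: level_charactersS eX'.
have [psi [psiI psiX psiS]] := @level_characters_basis R p p_pr m.
have psiL i : X m.+1 (psi i) by rewrite -psiX; exists i.
have pinv i : ball_inv m.+1 (psi i).
  by have [[_ _ eM] et] := psiL i; exact: trivial_on_ball_inv.
have [c uE] := psiS u uinv.
(* The average at level [m] fixes the characters of level [m] and kills the others. As it kills [u],
   the part of the expansion carried by level [m] is 0. *)
have u0 : \sum_(i | `[< X m (psi i) >]) c i *: psi i = 0.
  apply/funext => x; have := ulo m x (ltnSn m).
  rewrite uE (cavg_lin x c (leqnSn m) pinv) (bigID (fun i => `[< X m (psi i) >])) /=.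
  rewrite [X in _ + X]big1 ?addr0 => [|i /asboolP iN]; last first.
    by rewrite (@cavg_character _ m) ?mulr0.
  rewrite fct_sumE => S0; rewrite -[RHS]S0; apply: eq_bigr => i /asboolP iX.
  rewrite (@cavg_ball_inv _ m) //; have [[_ _ eM] et] := iX.
  exact: trivial_on_ball_inv.
rewrite uE (bigID (fun i => `[< X m (psi i) >])) /= u0 add0r; apply: lin_span_sum => i.
by move=> /asboolP iN; split.
Qed.

Lemma constant_basis : is_basis [set (fun=> 1 : R[i]^o)] (E 0).
Proof.
rewrite -level_characters0; split.
  by apply: (@level_characters_lin_indep _ _ _ 0); exact: level_charactersS.
rewrite level_characters0.
apply/seteqP; split=> [_ [k [e [c [eB ->]]]]|u /(D0_eigenspace_lambda mu_haar)[uinv _]].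
  apply: (ball_inv_eigenspace mu_haar) => // x y _; rewrite !fct_sumE.
  by apply: eq_bigr => i _; rewrite eB.
pose x0 : Zpx p_pr := lift (1%g : G 0).
exists 1%N, (fun=> fun=> 1), (fun=> u x0); split=> //.
rewrite big_ord1; apply/funext => x; rewrite -[RHS]/(u x0 * 1) mulr1; apply: uinv.
rewrite expr0 invr1 (le_trans (padic_abs_ultra _ _)) // padic_absN !Zpx_abs.
by rewrite maxxx.
Qed.

Definition level_card n := if n is m.+1 then (p.-1 * p ^ m)%N else 1%N.

Lemma card_level_characters n : (X n #= `I_(level_card n))%card.
Proof.
case: n => [|m] /=; first by rewrite level_characters0; exact: card_singleton.
have [psi [psiI <- _]] := @level_characters_basis R p p_pr m.
exact: card_range.
Qed.

Lemma card_conductor m : (X m.+1 `\` X m #= `I_(level_card m.+1 - level_card m)%N)%card.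
Proof.
have [psi [psiI psiX _]] := @level_characters_basis R p p_pr m.
have XE : psi @` [set i | `[< X m (psi i) >]] = X m.
  apply/seteqP; split=> [_ [i /asboolP iX <-]//|chi chiX].
  have : X m.+1 chi := level_charactersS (leqnSn m) chiX.
  by rewrite -psiX => -[i _ iE]; exists i => //; apply/asboolP; rewrite iE.
have DE : psi @` [set i | ~~ `[< X m (psi i) >]] = X m.+1 `\` X m.
  apply/seteqP; split=> [_ [i /asboolP iX <-]|chi [chiX chiN]].
    by split=> //; rewrite -psiX; exists i.
  move: chiX; rewrite -psiX => -[i _ iE]; exists i => //; apply/asboolP.
  by rewrite iE.
pose Q : pred 'I_(p.-1 * p ^ m) := fun i => `[< X m (psi i) >].
have c1 : (X m #= `I_#|Q|)%card by rewrite -XE; exact: (card_range_subset Q psiI).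
have /card_eq_II E := card_eq_trans (card_esym (card_level_characters m)) c1.
have := cardC Q; rewrite card_ord -E => cC.
have -> : (level_card m.+1 - level_card m = #|[predC Q]|)%N.
  by rewrite -[level_card m.+1]cC addKn.
by rewrite -DE; exact: (card_range_subset [predC Q] psiI).
Qed.

Lemma level_card_mult m : (level_card m.+1 - level_card m = mult p m.+1)%N.
Proof.
have := prime_gt1 p_pr; case: m => [|m] p1 /=.
  by rewrite expn0 muln1 -subn1 -subnDA.
rewrite -mulnBr; have -> : (p ^ m.+1 - p ^ m = (p - 1) * p ^ m)%N by rewrite expnS mulnBl mul1n.
by rewrite -subn1 mulnA mulnn.
Qed.

Lemma eigenspace_dim n : has_dim (E n) (mult p n).
Proof.
case: n => [|m].
  by exists [set (fun=> 1)]; [exact: card_singleton|exact: constant_basis].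
by exists (X m.+1 `\` X m); [rewrite -level_card_mult; exact: card_conductor|exact: conductor_basis].
Qed.

End FiniteAverages.

Theorem theorem2p2 (R : realType) (p : nat) (p_pr : prime p)
    (mu : {measure set (borelQp p_pr) -> \bar R}) (mu_haar : is_haar mu) :
  [/\ forall l : R[i],
        D0_eigenvalue mu l <->
        exists2 n : nat, (0 < mult p n)%N & l = lambda R[i] p n,
      is_basis [set (fun=> 1 : R[i]^o)] (D0_eigenspace mu (lambda R[i] p 0)),
      forall n : nat, (1 <= n)%N ->
        is_basis [set chi | is_character chi /\ has_conductor chi n]
          (D0_eigenspace mu (lambda R[i] p n))
    & forall n : nat, has_dim (D0_eigenspace mu (lambda R[i] p n)) (mult p n)].
Proof.
split.
- move=> l; split=> [[u uE u0]|[n n0 ->]]; last first.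
    have [u uE u0] := has_dim_neq0 n0 (eigenspace_dim mu_haar n).
    by exists u.
  have [n ln] : exists n, l = lambda R[i] p n.
    apply: contrapT => noln; case/eqP: u0.
    apply: (D0_eigenspace_other mu_haar _ uE) => n.
    by apply/eqP => ln; apply: noln; exists n.
  (* The multiplicity vanishes only for [p = 2] and [n = 1]; the eigenspace is then zero and [u]
     cannot lie in it. *)
  exists n => //; rewrite lt0n; apply/eqP => n0.
  have := eigenspace_dim mu_haar n; rewrite n0 -ln => /has_dim_eq0 /(_ u uE) uz.
  by rewrite uz eqxx in u0.
- exact: constant_basis.
- by case=> // m _; rewrite conductorS; exact: conductor_basis.
- exact: eigenspace_dim.
Qed.
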